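(* Let $q(t)=\sum_{k\ge 1} a_k t^k$ be a polynomial in one real variable with complex coefficients (so $q(0)=0$). Then there exist random variables $X$ and $Y$ with characteristic functions $\varphi_X(t)=\mathbb{E}e^{itX}$ and $\varphi_Y(t)=\mathbb{E}e^{itY}$ such that $$\varphi_X(t)=\varphi_Y(t)\exp\big(q(t)\big)\quad\text{for all } t\in\mathbb{R}$$ if and only if for every $k\ge 1$: $a_k\in\mathbb{R}$ when $k$ is even, and $a_k\in i\mathbb{R}$ when $k$ is odd.
   Context: Random variables $X,Y$ satisfying the displayed identity for some polynomial $q$ with $q(0)=0$ are called $Q$-identically distributed. *)

(* Defs.v *)
From mathcomp Require Import all_boot all_algebra.
From mathcomp Require Import all_classical all_reals all_analysis.
From mathcomp Require Export complex.
Import GRing.Theory Num.Theory.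
Local Open Scope ring_scope.
Local Open Scope complex_scope.

Definition charfun {R : realType} {d : measure_display} {T : measurableType d}
  (P : probability T R) (X : {RV P >-> R}) (t : R) : R[i] :=
  (Rintegral P setT (fun w => cos (t * X w)))
    +i* (Rintegral P setT (fun w => sin (t * X w))).

Definition cexp {R : realType} (z : R[i]) : R[i] :=
  (expR (complex.Re z))%:C * (cos (complex.Im z) +i* sin (complex.Im z)).

(* Main.v *)
From HB Require Import structures.
Require Import Defs.
From mathcomp Require Import all_boot all_order all_algebra.
From mathcomp Require Import all_classical all_reals all_analysis.
From mathcomp Require Import measurable_realfun complex ring lra.
Set Implicit Arguments.
Unset Strict Implicit.
Unset Printing Implicit Defensive.
Import Order.TTheory GRing.Theory Num.Theory.
Import numFieldNormedType.Exports.
Local Open Scope classical_set_scope.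
Local Open Scope ring_scope.

(** Necessity: [phi (- t)] is the conjugate of [phi t] and [phi_Y] does not
vanish near [0], so [exp (q (- t))] and [exp (conj (q t))] agree there.  Both
exponents are small, hence equal, and comparing coefficients gives the parity
condition.

Sufficiency: write [q = alpha + i beta] on the real line, with [alpha] even and
[beta] odd.  For small [e > 0] the function
[h s = (1 - |s|)^2 exp (q (e s))] on [[-1, 1]], extended by [0], is a
characteristic function.  Put [u = Re h] and [v = Im h] on [[0, 1]].  The
identity [int_R (1 - cos (a x)) / x^2 dx = kappa |a|] and Fubini show that
[h] is the Fourier transform of
[f x = 1 / (kappa x^2) int_0^1 (u'' s (1 - cos (s x))
                               - v'' s (sin (s x) - s sin x)) ds],
because [s |-> (s - t)_+] and [s |-> min (s, t) - s t] are the Green functions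
that recover [u] from [u''] (with [u 1 = u' 1 = 0]) and [v] from [v''] (with
[v 0 = v 1 = 0]).  The choice [q = 0] gives [u'' = 2] and [v'' = 0], so for
small [e] one has [u'' >= 1] and [|v''| <= 1/5], and then [f >= 0] follows from
[|sin (s x) - s sin x| <= 5 (1 - sin x / x)].  Finally take [X] with
characteristic function [h (t / e)] and [Y] the same with [q = 0]. *)

(** * Calculus and trigonometric inequalities *)

Section calculus.
Context {R : realType}.
Implicit Types (f g F : R -> R) (x : R).
Local Notation mu := (@lebesgue_measure R).

Lemma is_derive1_continuous f f' :
  (forall x, is_derive x 1 f (f' x)) -> continuous f.
Proof.
move=> df x; apply: differentiable_continuous.
by apply/derivable1_diffP; have [] := df x.
Qed.

(** Mean value theorem on [[0, x]]. It drives the ladder of Taylor bounds below: the derivative of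
    each difference is the difference treated just before. *)
Lemma is_derive_ge0 f f' : (forall x, is_derive x 1 f (f' x)) -> f 0 = 0 ->
  (forall x, 0 <= x -> 0 <= f' x) -> forall x, 0 <= x -> 0 <= f x.
Proof.
move=> df f0 f'0 x; rewrite le_eqVlt => /predU1P[<-|x0]; first by rewrite f0.
have cf := is_derive1_continuous df.
have wf : {within `[0, x], continuous f} by exact: continuous_subspaceT.
have [c] := MVT x0 (fun y _ => df y) wf.
rewrite in_itv/= => /andP[c0 _]; rewrite f0 !subr0 => ->.
by rewrite mulr_ge0 ?f'0// ltW.
Qed.

Lemma Rintegral_FTC f F a b : a <= b ->
  (forall x, is_derive x 1 F (f x)) -> continuous f ->
  \int[mu]_(x in `[a, b]) f x = F b - F a.
Proof.
rewrite le_eqVlt => /predU1P[<-|ab] dF cf.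
  by rewrite set_itv1 Rintegral_set1 subrr.
have cF := is_derive1_continuous dF.
rewrite /Rintegral (@continuous_FTC2 R f F)//.
- exact: continuous_subspaceT.
- split; first by move=> x _; have [] := dF x.
    by apply: cvg_at_right_filter; exact: cF.
  by apply: cvg_at_left_filter; exact: cF.
- by move=> x _; rewrite derive1E; have [] := dF x.
Qed.

Lemma continuous_normB (t : R) : continuous (fun s : R => `|s - t|).
Proof.
move=> s; apply: cvg_norm.
by apply: cvgB; [exact: cvg_id|exact: cvg_cst].
Qed.

Lemma continuous_normD (t : R) : continuous (fun s : R => `|s + t|).
Proof. by move=> s; have := @continuous_normB (- t) s; rewrite opprK. Qed.

Lemma sin_leid x : 0 <= x -> sin x <= x.
Proof.
move=> x0; rewrite -subr_ge0.
apply: (@is_derive_ge0 (fun y => y - sin y) (fun y => 1 - cos y)) => //.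
by rewrite sin0 subr0.
Qed.

Lemma cos_ge_taylor2 x : 1 - x ^+ 2 / 2 <= cos x.
Proof.
wlog x0 : x / 0 <= x.
  by move=> h; rewrite -cos_norm -real_normK ?num_real//; exact: h.
rewrite -subr_ge0.
apply: (@is_derive_ge0 (fun y => cos y - (1 - y ^+ 2 / 2))
  (fun y => y - sin y)) => //.
- move=> y; apply: is_derive_eq; rewrite /GRing.scale /=; lra.
- by rewrite cos0; lra.
- by move=> y y0; rewrite subr_ge0 sin_leid.
Qed.

Lemma sin_ge_taylor3 x : 0 <= x -> x - x ^+ 3 / 6 <= sin x.
Proof.
move=> x0; rewrite -subr_ge0.
apply: (@is_derive_ge0 (fun y => sin y - (y - y ^+ 3 / 6))
  (fun y => cos y - (1 - y ^+ 2 / 2))) => //.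
- move=> y; apply: is_derive_eq; rewrite /GRing.scale /=; lra.
- by rewrite sin0; lra.
- by move=> y y0; rewrite subr_ge0 cos_ge_taylor2.
Qed.

Lemma cos_le_taylor4 x : 0 <= x -> cos x <= 1 - x ^+ 2 / 2 + x ^+ 4 / 24.
Proof.
move=> x0; rewrite -subr_ge0.
apply: (@is_derive_ge0 (fun y => 1 - y ^+ 2 / 2 + y ^+ 4 / 24 - cos y)
  (fun y => sin y - (y - y ^+ 3 / 6))) => //.
- move=> y; apply: is_derive_eq; rewrite /GRing.scale /=; lra.
- by rewrite cos0; lra.
- by move=> y y0; rewrite subr_ge0 sin_ge_taylor3.
Qed.

Lemma sin_le_taylor5 x : 0 <= x -> sin x <= x - x ^+ 3 / 6 + x ^+ 5 / 120.
Proof.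
move=> x0; rewrite -subr_ge0.
apply: (@is_derive_ge0 (fun y => y - y ^+ 3 / 6 + y ^+ 5 / 120 - sin y)
  (fun y => 1 - y ^+ 2 / 2 + y ^+ 4 / 24 - cos y)) => //.
- move=> y; apply: is_derive_eq; rewrite /GRing.scale /=; lra.
- by rewrite sin0; lra.
- by move=> y y0; rewrite subr_ge0 cos_le_taylor4.
Qed.

(** This is what makes the density nonnegative. For [x >= 2] the trivial bound [2] on the defect
    suffices, since [2 * x <= 5 * (x - 1)]; for [x < 2] both sides are compared with [x ^+ 3]. *)
Lemma sin_defect_le s x : 0 <= s <= 1 -> 0 <= x ->
  x * `|sin (s * x) - s * sin x| <= 5 * (x - sin x).
Proof.
move=> /andP[s0 s1] x0; have sx0 : 0 <= s * x by rewrite mulr_ge0.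
have [x2|x2] := leP 2 x.
  have : `|sin (s * x) - s * sin x| <= 2.
    rewrite (le_trans (ler_normB _ _))// normrM (ger0_norm s0).
    have := sin_max (s * x); have := sin_max x; have := normr_ge0 (sin x).
    by nra.
  have := sin_le1 x; nra.
have h1 := sin_leid sx0; have h2 := sin_leid x0.
have h3 := sin_ge_taylor3 sx0; have h4 := sin_ge_taylor3 x0.
have h5 := sin_le_taylor5 x0.
have h6 : (s * x) ^+ 3 <= x ^+ 3.
  by rewrite lerXn2r ?nnegrE//; nra.
have h6' : s * (x - sin x) <= x ^+ 3 / 6 by nra.
(* Each side pairs the linear upper bound of one sine with the cubic lower bound of the other. *)
have h7 : `|sin (s * x) - s * sin x| <= x ^+ 3 / 6.
  rewrite ler_norml; apply/andP; split; nra.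
have h8 : 0 <= x ^+ 3 by rewrite exprn_ge0.
(* As [x ^+ 2 <= 4], the quintic bound leaves [1/6 - 4/120 = 2/15]. *)
have h9 : 2 / 15 * x ^+ 3 <= x - sin x.
  have : x ^+ 5 <= 4 * x ^+ 3.
    have -> : x ^+ 5 = x ^+ 2 * x ^+ 3 by rewrite -exprD.
    by rewrite ler_wpM2r//; nra.
  lra.
apply: le_trans (_ : 2 * (x ^+ 3 / 6) <= _); last by lra.
apply: ler_pM => //; exact: ltW.
Qed.

End calculus.

(** * The integral of (1 - cos (a x)) / x^2 *)

Section cosq.
Context {R : realType}.
Implicit Types (a s t x : R).
Local Notation mu := (@lebesgue_measure R).

(** Inversion is continuous only off [0], so the line is split into the point [0] and its open
    complement. *)
Lemma measurable_funV : measurable_fun [set: R] (fun x : R => x^-1).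
Proof.
rewrite -(setUv [set 0 : R]); apply/measurable_funU => //.
  exact: measurableC.
split; first exact: measurable_fun_set1.
apply: open_continuous_measurable_fun.
  by rewrite openC; exact: closed_eq.
by move=> x; rewrite inE/= => /eqP x0; exact: inv_continuous.
Qed.

Lemma integrable_oneDsqrV :
  mu.-integrable [set: R] (fun x => ((oneDsqr x)^-1)%:E).
Proof.
have cV := @continuous_oneDsqrV R.
apply/integrableP; split.
  by apply/measurable_EFinP; exact: continuous_measurable_fun.
under eq_integral do rewrite abse_EFin ger0_norm ?invr_ge0//.
rewrite ge0_symfun_integralT//.
- by rewrite -set_itvcy integral0y_oneDsqr -EFinM ltry.
- by move=> x; rewrite /oneDsqr /= sqrrN.
Qed.

Lemma le_oneDsqr_integrable (f : R -> R) C : measurable_fun [set: R] f ->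
  (forall x, `|f x| <= C * (oneDsqr x)^-1) ->
  mu.-integrable [set: R] (EFin \o f).
Proof.
move=> mf fC; apply: (le_integrable measurableT _ _
  (integrableZl measurableT C integrable_oneDsqrV)); first exact/measurable_EFinP.
by move=> x _ /=; rewrite lee_fin (le_trans (fC x))// ler_norm.
Qed.

(* At [x = 0] the quotient takes the junk value [0], a null-set change. *)
Definition cosq a x : R := (1 - cos (a * x)) / x ^+ 2.

Lemma cosq_ge0 a x : 0 <= cosq a x.
Proof. by rewrite divr_ge0 ?sqr_ge0// subr_ge0 cos_le1. Qed.

(** The first bound, multiplied by [x ^+ 2], controls infinity and the second controls the origin;
    their sum is [|y| (1 + x^2) <= 2 C x^2]. *)
Lemma divr_sqr_le_oneDsqr y C x : `|y| <= C -> `|y| <= C * x ^+ 2 ->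
  `|y / x ^+ 2| <= (C + C) * (oneDsqr x)^-1.
Proof.
move=> y1 y2; have C0 : 0 <= C by exact: le_trans y1.
have [->|x0] := eqVneq x 0.
  by rewrite expr0n/= invr0 mulr0 normr0 mulr_ge0 ?addr_ge0 ?invr_ge0.
have x20 : 0 < x ^+ 2 by rewrite exprn_even_gt0.
rewrite normrM normfV (gtr0_norm x20) ler_pdivlMr// mulrAC ler_pdivrMr//.
rewrite /oneDsqr mulrDr mulr1 mulrDl addrC lerD//.
by rewrite ler_wpM2r ?sqr_ge0.
Qed.

Lemma norm_1Bcos_le s x : 0 <= s <= 1 ->
  `|1 - cos (s * x)| <= 2 /\ `|1 - cos (s * x)| <= 2 * x ^+ 2.
Proof.
move=> /andP[s0 s1].
rewrite ger0_norm ?subr_ge0 ?cos_le1//.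
have := cos_geN1 (s * x); have := cos_ge_taylor2 (s * x).
have : (s * x) ^+ 2 <= x ^+ 2.
  by rewrite exprMn ler_piMl ?sqr_ge0// expr_le1.
by have := sqr_ge0 x; split; lra.
Qed.

Lemma norm_sin_defect_normr s x :
  `|sin (s * `|x|) - s * sin `|x| | = `|sin (s * x) - s * sin x|.
Proof.
have [x0|x0] := ger0P x => //.
by rewrite !(mulrN, sinN) opprK -[in RHS]normrN opprD opprK.
Qed.

(** The linear terms of the two sines cancel at the origin and leave a cubic remainder, so that
    division by [x ^+ 2] does no harm. *)
Lemma norm_sin_defect_le s x : 0 <= s <= 1 ->
  `|sin (s * x) - s * sin x| <= 2 /\ `|sin (s * x) - s * sin x| <= 2 * x ^+ 2.
Proof.
move=> s01; have /andP[s0 s1] := s01.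
have h2 : `|sin (s * x) - s * sin x| <= 2.
  rewrite (le_trans (ler_normB _ _))// normrM (ger0_norm s0).
  have := sin_max (s * x); have := sin_max x; have := normr_ge0 (sin x).
  by nra.
(* For [x ^+ 2 >= 1] the constant bound suffices; otherwise [x] is replaced by its absolute value,
   which is below [1], so that cubes are below squares. *)
split=> //; have [x1|x1] := leP 1 (x ^+ 2); first by lra.
rewrite -norm_sin_defect_normr -real_normK ?num_real//.
have {h2}x1 : `|x| < 1.
  by rewrite -(ltr_pXn2r (n := 2)) ?nnegrE// real_normK ?num_real// expr1n.
move: `|x| (normr_ge0 x) x1 => {}x x0 x1.
have sx0 : 0 <= s * x by rewrite mulr_ge0.
have h1 := sin_leid sx0; have h2 := sin_leid x0.
have h3 := sin_ge_taylor3 sx0; have h4 := sin_ge_taylor3 x0.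
have h6 : (s * x) ^+ 3 <= x ^+ 3.
  by rewrite lerXn2r ?nnegrE//; nra.
have h7 : x ^+ 3 <= x ^+ 2 by rewrite exprS; nra.
have h8 : 0 <= x ^+ 3 by rewrite exprn_ge0.
have h6' : s * (x - sin x) <= x ^+ 3 / 6 by nra.
by rewrite ler_norml; apply/andP; split; nra.
Qed.

Lemma measurable_cosq a : measurable_fun [set: R] (cosq a).
Proof.
apply: measurable_funM.
  apply: measurable_funB => //.
  apply: continuous_measurable_fun => x; apply: continuous_comp.
    exact: mulrl_continuous.
  exact: continuous_cos.
apply: (measurableT_comp measurable_funV).
exact: exprn_measurable.
Qed.

Lemma integrable_cosq a : mu.-integrable [set: R] (EFin \o cosq a).
Proof.
apply: (@le_oneDsqr_integrable _ ((2 + a ^+ 2) + (2 + a ^+ 2))).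
  exact: measurable_cosq.
move=> x; apply: divr_sqr_le_oneDsqr.
  rewrite ger0_norm ?subr_ge0 ?cos_le1//.
  by have := cos_geN1 (a * x); have := sqr_ge0 a; lra.
rewrite ger0_norm ?subr_ge0 ?cos_le1//.
have := cos_ge_taylor2 (a * x).
rewrite exprMn; have := sqr_ge0 x; have := sqr_ge0 a.
set X := x ^+ 2; set A := a ^+ 2 => A0 X0; nra.
Qed.

(** The image of Lebesgue measure under multiplication by [a], rescaled by [a], agrees with Lebesgue
    measure on half-open intervals, hence on all measurable sets. *)
Lemma ge0_integral_lebesgue_scale (f : R -> \bar R) a : 0 < a ->
  measurable_fun [set: R] f -> (forall x, 0 <= f x)%E ->
  (\int[mu]_x f x = a%:E * \int[mu]_x f (a * x)%R)%E.
Proof.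
move=> a0 mf f0.
have ma : measurable_fun [set: measurableTypeR R]
    (fun x : measurableTypeR R => (a * x : measurableTypeR R)).
  exact: mulrl_measurable.
pose nu := mscale (NngNum (ltW a0))
  (pushforward mu (fun x : measurableTypeR R => (a * x : measurableTypeR R))).
transitivity (\int[nu ma]_x f x)%E.
  apply: eq_measure_integral => A mA _.
  apply: lebesgue_measure_unique => //= _ [[p q] _ <-].
  rewrite /nu /mscale /pushforward/=.
  rewrite [X in (_ * lebesgue_measure X)%E](_ : _ = `]p / a, q / a]%classic); last first.
    apply/seteqP; split => x /=; rewrite !in_itv/= ltr_pdivrMr// ler_pdivlMr//.
      by rewrite mulrC.
    by rewrite mulrC.
  rewrite !lebesgue_measure_itv/= !lte_fin ltr_pM2r ?invr_gt0//.
  case: ifPn => _; last by rewrite mule0.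
  by rewrite -!EFinB -EFinM -mulrBl mulrCA divff ?mulr1// gt_eqF.
rewrite ge0_integral_mscale//=; congr *%E.
by rewrite ge0_integral_pushforward.
Qed.

(** The constant kappa of the overview; classically it is pi. *)
Definition cosq_mass : R := \int[mu]_x cosq 1 x.

Lemma cosq_mass_gt0 : 0 < cosq_mass.
Proof.
have h1 := @cos1_gt0 R.
have c1 : cos 1 < 1 :> R.
  have pi2 := @pi_ge2 R.
  by rewrite -[ltRHS]cos0 ltr_cos ?ltr01// in_itv/= ?lexx; lra.
suff : (((1 - cos 1) / 4)%:E <= cosq_mass%:E)%E.
  by rewrite lee_fin; apply: lt_le_trans; rewrite divr_gt0 ?subr_gt0.
rewrite /cosq_mass /Rintegral fineK; last first.
  exact: (integrable_fin_num measurableT (integrable_cosq 1)).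
(* On [[1, 2]], inside the range [[0, pi]] where cosine decreases, the integrand is at least
   [(1 - cos 1) / 4]. *)
apply: (@le_trans _ _ (\int[mu]_(x in `[1%R, 2%R]) (cosq 1 x)%:E)%E); last first.
  apply: ge0_subset_integral => //; last by move=> x _; rewrite lee_fin cosq_ge0.
  by apply/measurable_EFinP; exact: measurable_cosq.
apply: (@le_trans _ _ (\int[mu]_(x in `[1%R, 2%R]) ((1 - cos 1) / 4)%:E)%E).
  rewrite integral_cst//= lebesgue_measure_itv/= lte_fin ltr1n -EFinB -EFinM.
  by rewrite lee_fin; lra.
apply: ge0_le_integral => //.
- apply/measurable_EFinP; apply: measurable_funS (measurable_cosq 1) => //.
- move=> x /=; rewrite in_itv/= => /andP[x1 x2]; rewrite lee_fin /cosq mul1r.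
  have : cos x <= cos 1.
    have := @pi_ge2 R => pi2.
    by rewrite leNgt ltr_cos -?leNgt// in_itv/=; apply/andP; split; lra.
  move=> cx; apply: ler_pM; [lra|by rewrite invr_ge0|lra|].
  by rewrite lef_pV2 ?posrE ?exprn_gt0//; nra.
Qed.

(** By evenness in [a] only [a > 0] matters; the substitution of [a * x] for [x] then produces the
    factor [a * a^-2]. *)
Lemma Rintegral_cosq a : \int[mu]_x cosq a x = cosq_mass * `|a|.
Proof.
wlog : a / 0 <= a.
  move=> h; have [/h//|/ltW a0] := leP 0 a.
  rewrite -normrN -h ?oppr_ge0//; apply: eq_Rintegral => x _.
  by rewrite /cosq mulNr cosN.
rewrite le_eqVlt => /predU1P[<-|a0].
  rewrite normr0 mulr0 /Rintegral; under eq_integral do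
    rewrite /cosq mul0r cos0 subrr mul0r.
  by rewrite integral0.
have mass : (\int[mu]_x (cosq 1 x)%:E =
    a%:E * ((a ^- 2)%:E * (\int[mu]_x cosq a x)%:E))%E.
  rewrite (@ge0_integral_lebesgue_scale _ a)//; last 2 first.
  - by apply/measurable_EFinP; exact: measurable_cosq.
  - by move=> x; rewrite lee_fin cosq_ge0.
  congr *%E; rewrite [in RHS]/Rintegral fineK; last first.
    exact: (integrable_fin_num measurableT (integrable_cosq a)).
  rewrite -(integralZl measurableT (integrable_cosq a)).
  apply: eq_integral => x _ /=; rewrite -EFinM /cosq mul1r; congr EFin.
  have [->|x0] := eqVneq x 0; first by rewrite !mulr0 expr0n/= invr0 !mulr0.
  by rewrite exprMn; field; rewrite x0 gt_eqF.
rewrite gtr0_norm// /cosq_mass [in RHS]/Rintegral mass -!EFinM /=.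
by rewrite mulrAC mulrA -expr2 divff ?mul1r// expf_neq0// gt_eqF.
Qed.

(** Lebesgue measure is invariant under reflection, so the integral equals its own opposite. *)
Lemma Rintegral_odd (f : R -> R) : mu.-integrable [set: R] (EFin \o f) ->
  (forall x, f (- x) = - f x) -> \int[mu]_x f x = 0.
Proof.
move=> intf oddf.
suff /eqP : \int[mu]_x f x = - \int[mu]_x f x.
  by rewrite -addr_eq0 -mulr2n mulrn_eq0/= => /eqP.
rewrite {1}/Rintegral.
have mN : measurable_fun [set: R] (-%R : R -> measurableTypeR R).
  exact: oppr_measurable.
have -> : (\int[mu]_x (f x)%:E =
    \int[pushforward mu (-%R : R -> measurableTypeR R)]_x (f x)%:E)%E.
  apply: eq_measure_integral => A mA _; exact/esym/lebesgue_measureN.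
have cE : (EFin \o f) \o -%R = (fun x => (- 1)%:E * (f x)%:E)%E.
  by apply/funext => x /=; rewrite oddf -EFinM mulN1r.
rewrite integral_pushforward//=.
- rewrite preimage_setT [X in fine (integral _ _ X)]cE integralZl//.
  by rewrite fineM ?mulN1r//; exact: integrable_fin_num.
- exact: measurable_int intf.
- by rewrite preimage_setT cE; exact: (integrableZl measurableT _ intf).
Qed.

End cosq.

(** * Probabilities with a density *)

Lemma integrable_probability_bounded (R : realType) d (T : measurableType d)
    (P : probability T R) (g : T -> R) :
  measurable_fun [set: T] g -> (forall x, `|g x| <= 1) ->
  P.-integrable [set: T] (EFin \o g).
Proof.
move=> mg g1; apply: measurable_bounded_integrable => //.
  by rewrite (le_lt_trans (probability_le1 _ _)) ?ltry.
exists 1; split; first exact: num_real.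
by move=> M M1 x _ /=; rewrite (le_trans (g1 x))// ltW.
Qed.

Section density.
Context {R : realType}.
Local Notation mu := (@lebesgue_measure R).
Variable f : R -> R.
Hypothesis f_ge0 : forall x, 0 <= f x.
Hypothesis intf : mu.-integrable [set: R] (EFin \o f).
Hypothesis f1 : \int[mu]_x f x = 1.

Definition density_prob (A : set (measurableTypeR R)) : \bar R :=
  (\int[mu]_(x in A) (f x)%:E)%E.

Let density0 : density_prob set0 = 0%E.
Proof. exact: integral_set0. Qed.

Let density_ge0 A : (0 <= density_prob A)%E.
Proof. by apply: integral_ge0 => x _; rewrite lee_fin. Qed.

Let density_sigma_additive : semi_sigma_additive density_prob.
Proof.
move=> /= A mA tA mUA.
rewrite /density_prob/= integral_bigcup//=; last first.
  exact: (integrableS _ _ (subsetT _)).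
apply: is_cvg_ereal_nneg_natsum_cond => n _ _.
by apply: integral_ge0 => /= x ?; rewrite lee_fin.
Qed.

HB.instance Definition _ := isMeasure.Build _ _ _
  density_prob density0 density_ge0 density_sigma_additive.

Let density_setT : density_prob [set: _] = 1%E.
Proof.
rewrite /density_prob -f1 /Rintegral fineK//.
exact: (integrable_fin_num measurableT intf).
Qed.

HB.instance Definition _ :=
  @Measure_isProbability.Build _ _ R density_prob density_setT.

Let density_dom : density_prob `<< mu.
Proof.
apply/null_content_dominatesP=> A mA muA0.
apply: null_set_integral => //.
exact: measurable_funTS (measurable_int mu intf).
Qed.

Lemma exists_density_prob : exists P : probability (measurableTypeR R) R,
  forall g : R -> R, measurable_fun [set: R] g -> (forall x, `|g x| <= 1) ->
    \int[P]_x g x = \int[mu]_x (g x * f x).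
Proof.
exists density_prob => g mg g1; rewrite /Rintegral; congr fine.
have mf := measurable_int mu intf.
have intg : (density_prob : probability (measurableTypeR R) R).-integrable
    [set: R] (EFin \o g) by exact: integrable_probability_bounded.
(* The Radon-Nikodym derivative of the new measure is almost everywhere [f], because the two have
   the same integral over every measurable set. *)
rewrite -(Radon_Nikodym_change_of_variables density_dom)//=.
apply: ae_eq_integral => //.
- by apply: emeasurable_funM => //; exact/measurable_EFinP.
- exact/measurable_EFinP/measurable_funM/measurable_EFinP.
under [X in ae_eq _ _ _ X]eq_fun do rewrite EFinM.
apply: ae_eqe_mul2l => /=.
rewrite Radon_NikodymE//=; case: cid => /= h [h1 h2 h3].
apply: integral_ae_eq => //=.
by move=> E _ mE; rewrite -h3.
Qed.

End density.

(** * Fourier transforms of the kernels *)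

Section transforms.
Context {R : realType}.
Implicit Types s t x k : R.
Local Notation mu := (@lebesgue_measure R).

Lemma measurable_cosM k : measurable_fun [set: R] (fun x => cos (k * x)).
Proof.
apply: continuous_measurable_fun => x; apply: continuous_comp.
  exact: mulrl_continuous.
exact: continuous_cos.
Qed.

Lemma measurable_sinM k : measurable_fun [set: R] (fun x => sin (k * x)).
Proof.
apply: continuous_measurable_fun => x; apply: continuous_comp.
  exact: mulrl_continuous.
exact: continuous_sin.
Qed.

Lemma integrable_divr_sqrM (y e : R -> R) C :
  measurable_fun [set: R] y -> measurable_fun [set: R] e ->
  (forall x, `|y x| <= C /\ `|y x| <= C * x ^+ 2) ->
  (forall x, `|e x| <= 1) ->
  mu.-integrable [set: R] (EFin \o (fun x => y x / x ^+ 2 * e x)).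
Proof.
move=> my me yC e1; apply: (@le_oneDsqr_integrable _ _ (C + C)).
  apply: measurable_funM => //; apply: measurable_funM => //.
  apply: (measurableT_comp (@measurable_funV R)).
  exact: exprn_measurable.
move=> x; rewrite normrM -[leRHS]mulr1 ler_pM//.
by have [? ?] := yC x; exact: divr_sqr_le_oneDsqr.
Qed.

Lemma integrable_cosqZ k s : mu.-integrable [set: R] (EFin \o (fun x => k * cosq s x)).
Proof. exact: (integrableZl measurableT k (integrable_cosq s)). Qed.

Lemma cosqZE k s : \int[mu]_x (k * cosq s x) = k * (cosq_mass * `|s|).
Proof. by rewrite RintegralZl ?Rintegral_cosq//; exact: integrable_cosq. Qed.

Lemma integrable_EFinD (f g : R -> R) : mu.-integrable [set: R] (EFin \o f) ->
  mu.-integrable [set: R] (EFin \o g) ->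
  mu.-integrable [set: R] (EFin \o (fun x => f x + g x)).
Proof. by move=> intf intg; exact: (integrableD measurableT intf intg). Qed.

(** Here and in the next lemma, product-to-sum formulas turn the integrand into a linear combination
    of functions [cosq], whose integrals are known. *)
Lemma Rintegral_1Bcos_cos s t :
  \int[mu]_x ((1 - cos (s * x)) / x ^+ 2 * cos (t * x)) =
  cosq_mass * ((`|s + t| + `|s - t|) / 2 - `|t|).
Proof.
transitivity (\int[mu]_x (2^-1 * cosq (s + t) x + 2^-1 * cosq (s - t) x
    + -1 * cosq t x)).
  apply: eq_Rintegral => x _; rewrite /cosq.
  have -> : (s + t) * x = s * x + t * x by ring.
  have -> : (s - t) * x = s * x - t * x by ring.
  by rewrite cosD cosB; set Y := (x ^+ 2)^-1; field.
have i1 k u := integrable_cosqZ k u.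
rewrite !RintegralD//; try exact: i1.
  by rewrite !cosqZE; move: cosq_mass => m; field.
by apply: integrable_EFinD; exact: i1.
Qed.

Lemma Rintegral_sin_defect_sin s t : 
  \int[mu]_x ((sin (s * x) - s * sin x) / x ^+ 2 * sin (t * x)) =
  cosq_mass * ((`|s + t| - `|s - t|) / 2 - s * ((`|1 + t| - `|1 - t|) / 2)).
Proof.
transitivity (\int[mu]_x (2^-1 * cosq (s + t) x + - 2^-1 * cosq (s - t) x
    + (- (s / 2) * cosq (1 + t) x + s / 2 * cosq (1 - t) x))).
  apply: eq_Rintegral => x _; rewrite /cosq.
  have -> : (s + t) * x = s * x + t * x by ring.
  have -> : (s - t) * x = s * x - t * x by ring.
  have -> : (1 + t) * x = x + t * x by ring.
  have -> : (1 - t) * x = x - t * x by ring.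
  by rewrite !cosB !cosD; set Y := (x ^+ 2)^-1; field.
have i1 k u := integrable_cosqZ k u.
rewrite !RintegralD//; try exact: i1.
- by rewrite !cosqZE; move: cosq_mass => m; field.
- by apply: integrable_EFinD; exact: i1.
- by apply: integrable_EFinD; exact: i1.
Qed.

Lemma integrable_1Bcos s (e : R -> R) : 0 <= s <= 1 -> measurable_fun [set: R] e ->
  (forall x, `|e x| <= 1) ->
  mu.-integrable [set: R] (EFin \o (fun x => (1 - cos (s * x)) / x ^+ 2 * e x)).
Proof.
move=> s01 me e1; apply: (@integrable_divr_sqrM _ _ 2) => //.
  by apply: measurable_funB => //; exact: measurable_cosM.
by move=> x; exact: norm_1Bcos_le.
Qed.

Lemma integrable_sin_defect s (e : R -> R) : 0 <= s <= 1 ->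
  measurable_fun [set: R] e -> (forall x, `|e x| <= 1) ->
  mu.-integrable [set: R]
    (EFin \o (fun x => (sin (s * x) - s * sin x) / x ^+ 2 * e x)).
Proof.
move=> s01 me e1; apply: (@integrable_divr_sqrM _ _ 2) => //.
  apply: measurable_funB; first exact: measurable_sinM.
  apply: measurable_funM => //.
  by apply: continuous_measurable_fun; exact: continuous_sin.
by move=> x; exact: norm_sin_defect_le.
Qed.

(** The integrand is odd. With the next lemma this separates the transforms: the cosine transform
    sees only [a], the sine transform only [b]. *)
Lemma Rintegral_1Bcos_sin s t : 0 <= s <= 1 ->
  \int[mu]_x ((1 - cos (s * x)) / x ^+ 2 * sin (t * x)) = 0.
Proof.
move=> s01; apply: Rintegral_odd.
  apply: integrable_1Bcos => //; first exact: measurable_sinM.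
  by move=> x; exact: sin_max.
by move=> x; rewrite !mulrN sinN cosN sqrrN mulrN.
Qed.

Lemma Rintegral_sin_defect_cos s t : 0 <= s <= 1 ->
  \int[mu]_x ((sin (s * x) - s * sin x) / x ^+ 2 * cos (t * x)) = 0.
Proof.
move=> s01; apply: Rintegral_odd.
  apply: integrable_sin_defect => //; first exact: measurable_cosM.
  by move=> x; exact: cos_max.
by move=> x; rewrite !(mulrN, sinN) cosN sqrrN -opprD !mulNr.
Qed.

End transforms.

(** * The density attached to a pair of second derivatives *)

Section kernel.
Context {R : realType}.
Local Notation mu := (@lebesgue_measure R).
Variables (a b : R -> R) (M : R).
Hypothesis ma : measurable_fun [set: R] a.
Hypothesis mb : measurable_fun [set: R] b.
Hypothesis a_out : forall s : R, s \notin `[0, 1] -> a s = 0.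
Hypothesis b_out : forall s : R, s \notin `[0, 1] -> b s = 0.
Hypothesis a_in : forall s : R, s \in `[0, 1] -> 1 <= a s <= M.
Hypothesis b_in : forall s : R, s \in `[0, 1] -> `|b s| <= 5^-1.

(** Here [a] and [b] stand for [u''] and [v''], cut off outside [[0, 1]] so that [s] may run over
    the whole line. The term [s * sin x] removes the [1 / x] singularity of
    [sin (s * x) / x ^+ 2]. *)
Definition polya_kernel s x : R :=
  (a s * (1 - cos (s * x)) - b s * (sin (s * x) - s * sin x)) / x ^+ 2.
Local Notation G := polya_kernel.

Definition polya_density x : R := cosq_mass^-1 * \int[mu]_s G s x.

Let C := (2 * M + 2) + (2 * M + 2).

Let C_ge0 : 0 <= C.
Proof.
have /andP[] : 1 <= a 0 <= M by apply: a_in; rewrite in_itv/= lexx ler01.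
by rewrite /C; lra.
Qed.

Let G_out s x : s \notin `[0, 1] -> G s x = 0.
Proof. by move=> s01; rewrite /G a_out// b_out// !mul0r subrr mul0r. Qed.

(** The numerator is at most [2 * M + 2], also after a factor [x ^+ 2], and [divr_sqr_le_oneDsqr]
    doubles this constant. The bound is a product of integrable functions of [s] and of [x], as
    Fubini requires. *)
Let G_le s x : `|G s x| <= C * (\1_`[0, 1] s * (oneDsqr x)^-1).
Proof.
have [s01|s01] := boolP (s \in `[0, 1]); last first.
  by rewrite G_out// normr0 mulr_ge0// mulr_ge0 ?invr_ge0.
rewrite indicE mem_set// mul1r.
have s01' : 0 <= s <= 1 by move: s01; rewrite in_itv.
have [c1 c2] := norm_1Bcos_le x s01'; have [d1 d2] := norm_sin_defect_le x s01'.
have /andP[a1 aM] := a_in s01; have b1 := b_in s01.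
have aC : `|a s| <= M by rewrite ger0_norm//; lra.
have bC : `|b s| <= 1 by lra.
apply: divr_sqr_le_oneDsqr; rewrite (le_trans (ler_normB _ _))// !normrM.
  rewrite [2 * M]mulrC lerD//; first exact: ler_pM.
  by rewrite -[leRHS]mul1r; exact: ler_pM.
rewrite mulrDl lerD//.
  by rewrite -mulrA mulrCA; exact: ler_pM.
by rewrite -[leRHS]mul1r; exact: ler_pM.
Qed.

Let measurable_G2 :
  measurable_fun [set: (measurableTypeR R * measurableTypeR R)%type]
    (fun z => G z.1 z.2).
Proof.
have m1 : measurable_fun [set: (measurableTypeR R * measurableTypeR R)%type]
    (fun z => z.1 : R) by exact: measurable_fst.
have m2 : measurable_fun [set: (measurableTypeR R * measurableTypeR R)%type]
    (fun z => z.2 : R) by exact: measurable_snd.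
have mcos : measurable_fun [set: R] (@cos R).
  by apply: continuous_measurable_fun; exact: continuous_cos.
have msin : measurable_fun [set: R] (@sin R).
  by apply: continuous_measurable_fun; exact: continuous_sin.
apply: measurable_funM; last first.
  apply: (measurableT_comp (@measurable_funV R)).
  exact: measurable_funX.
apply: measurable_funB.
  apply: measurable_funM; first exact: (measurableT_comp ma).
  apply: measurable_funB => //; apply: (measurableT_comp mcos).
  exact: measurable_funM.
apply: measurable_funM; first exact: (measurableT_comp mb).
apply: measurable_funB; first by apply: (measurableT_comp msin); exact: measurable_funM.
by apply: measurable_funM => //; exact: (measurableT_comp msin).
Qed.

Let measurable_Gr s : measurable_fun [set: R] (G s).
Proof. exact: (measurableT_comp measurable_G2 (measurable_pair1 s)). Qed.

Let measurable_Gl x : measurable_fun [set: R] (G^~ x).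
Proof. exact: (measurableT_comp measurable_G2 (measurable_pair2 x)). Qed.

Let integrable_Gr s (e : R -> R) : measurable_fun [set: R] e ->
  (forall x, `|e x| <= 1) ->
  mu.-integrable [set: R] (fun x => (G s x * e x)%:E).
Proof.
move=> me e1; apply: (@le_oneDsqr_integrable _ _ C).
  by apply: measurable_funM.
move=> x; rewrite normrM -[leRHS]mulr1 ler_pM//.
by rewrite (le_trans (G_le s x))// ler_wpM2l// ler_piMl ?invr_ge0//.
Qed.

Let integrable_Gl x : mu.-integrable [set: R] (fun s => (G s x)%:E).
Proof.
have i01 : mu.-integrable [set: R] (fun s => (C * (oneDsqr x)^-1)%:E *
    (\1_(`[0, 1]%classic : set R) s)%:E)%E.
  by apply: integrableZl => //; exact: integrable_indic_itv.
apply: (le_integrable measurableT _ _ i01).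
  by apply/measurable_EFinP; exact: measurable_Gl.
move=> s _ /=; rewrite lee_fin (le_trans (G_le s x))//.
by rewrite mulrA mulrAC ler_norm.
Qed.

(** From [a >= 1], [|b| <= 1/5] and [sin_defect_le] the kernel is at least [H s] below. The integral
    of [H] over [[0, 1]] is zero because [cos (s * x)] has mean [sin x / x] there. *)
Lemma polya_density_ge0 x : 0 <= polya_density x.
Proof.
rewrite mulr_ge0 ?invr_ge0 ?(ltW cosq_mass_gt0)//.
(* At [x = 0] division by zero makes the kernel vanish. *)
have [->|x0] := eqVneq x 0.
  by apply: Rintegral_ge0 => s _; rewrite /G expr0n/= invr0 mulr0.
have -> : \int[mu]_s G s x = \int[mu]_(s in `[0, 1]) G s x.
  rewrite [RHS]Rintegral_mkcond; apply: eq_Rintegral => s _.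
  rewrite patchE; case: ifPn => //; rewrite notin_setE/= => s01.
  by rewrite G_out//; exact/negP.
pose H (s : R) : R := ((1 - cos (s * x)) - (1 - sin x / x)) / x ^+ 2.
have cH : continuous H.
  move=> s; apply: cvgMl; apply: cvgB; last exact: cvg_cst.
  apply: cvgB; first exact: cvg_cst.
  apply: continuous_comp; first exact: mulrr_continuous.
  exact: continuous_cos.
have H0 : \int[mu]_(s in `[0, 1]) H s = 0.
  pose F (s : R) : R := ((s - sin (s * x) / x) - s * (1 - sin x / x)) / x ^+ 2.
  have dF (s : R) : is_derive s 1 F (H s).
    have dsin : is_derive s 1 (fun s : R => sin (s * x)) (cos (s * x) * x).
      apply: (@is_derive1_comp _ sin (fun s : R => s * x)).
      by apply: is_derive_eq; rewrite /GRing.scale /=; lra.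
    apply: is_derive_eq.
    by rewrite /GRing.scale /= /H; field.
  rewrite (Rintegral_FTC ler01 dF cH) /F.
  by rewrite !mul0r !mul1r sin0 mul0r; field.
rewrite -[leLHS]H0; apply: le_Rintegral => //.
- apply: continuous_compact_integrable; first exact: segment_compact.
  exact: continuous_subspaceT.
- exact: (integrableS measurableT _ _ (integrable_Gl x)).
move=> s; rewrite /= => s01.
rewrite /H /G ler_wpM2r ?invr_ge0 ?sqr_ge0//.
have s01' : 0 <= s <= 1 by move: s01; rewrite in_itv.
have /andP[a1 _] := a_in s01; have b1 := b_in s01.
have h1 : 1 - cos (s * x) <= a s * (1 - cos (s * x)).
  by rewrite ler_peMl// subr_ge0 cos_le1.
apply: lerB => //.
have h : `|sin (s * x) - s * sin x| <= 5 * (1 - sin x / x).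
  rewrite -norm_sin_defect_normr.
  have -> : sin x / x = sin `|x| / `|x|.
    by have [//|_] := ger0P x; rewrite sinN invrN mulrNN.
  have X0 : 0 < `|x| by rewrite normr_gt0.
  rewrite -(ler_pM2l X0) (le_trans (sin_defect_le s01' (ltW X0)))//.
  by rewrite mulrCA ler_pM2l// mulrBr mulr1 mulrCA divff ?mulr1// gt_eqF.
rewrite (le_trans (ler_norm _))// normrM.
rewrite (le_trans (ler_pM _ _ b1 h))//.
by rewrite mulrA mulVf ?mul1r.
Qed.

Section fubini.
Variable e : R -> R.
Hypothesis me : measurable_fun [set: R] e.
Hypothesis e1 : forall x, `|e x| <= 1.

Let F (z : measurableTypeR R * measurableTypeR R) : \bar R :=
  (G z.1 z.2 * e z.2)%:E.

Let integrableF : (mu \x mu)%E.-integrable [set: measurableTypeR R * measurableTypeR R] F.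
Proof.
pose H (z : measurableTypeR R * measurableTypeR R) : \bar R :=
  (C * (\1_(`[0, 1]%classic : set R) z.1 * (oneDsqr z.2)^-1))%:E.
have mH : measurable_fun setT H.
  apply/measurable_EFinP; apply: measurable_funM => //.
  apply: measurable_funM.
    exact: (measurableT_comp _ measurable_fst).
  have mV : measurable_fun [set: R] (fun x : R => (oneDsqr x)^-1).
    by apply: continuous_measurable_fun; exact: continuous_oneDsqrV.
  exact: (measurableT_comp mV measurable_snd).
have iH : (mu \x mu)%E.-integrable setT H.
  apply/(integrable12ltyP mu mu mH).
  have -> : (\int[mu]_x \int[mu]_y `|H (x, y)| =
      \int[mu]_x ((C * fine (\int[mu]_y ((oneDsqr y)^-1)%:E))%:E *
                   (\1_(`[0, 1]%classic : set R) x)%:E))%E.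
    apply: eq_integral => s _.
    under eq_integral => y _.
      rewrite /H/= ger0_norm; last by rewrite mulr_ge0// mulr_ge0// invr_ge0.
      rewrite mulrA EFinM; over.
    rewrite integralZl//; last exact: integrable_oneDsqrV.
    rewrite 2!EFinM fineK; last first.
      exact: (integrable_fin_num measurableT integrable_oneDsqrV).
    by rewrite muleAC.
  apply: integrable_lty => //; apply: integrableZl => //.
  exact: integrable_indic_itv.
apply: (le_integrable measurableT _ _ iH).
  apply/measurable_EFinP; apply: measurable_funM => //.
  exact: (measurableT_comp me measurable_snd).
move=> z _; rewrite lee_fin normrM.
rewrite [leRHS]ger0_norm; last by rewrite mulr_ge0// mulr_ge0// invr_ge0.
by rewrite -[leRHS]mulr1 ler_pM.
Qed.

Let innerE x : (\int[mu]_s F (s, x) = (\int[mu]_s G s x * e x)%:E)%E.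
Proof.
rewrite /F/=; under eq_integral do rewrite mulrC EFinM.
rewrite integralZl// EFinM muleC; congr *%E.
by rewrite /Rintegral fineK//; exact: (integrable_fin_num measurableT (integrable_Gl x)).
Qed.

Let EFin_densityE x :
  ((polya_density x * e x)%:E = cosq_mass^-1%:E * \int[mu]_s F (s, x))%E.
Proof. by rewrite innerE -EFinM mulrA. Qed.

Let Rintegral_G_le x : `|\int[mu]_s G s x| <= C * (oneDsqr x)^-1.
Proof.
have i01 : mu.-integrable [set: R] (EFin \o \1_(`[0, 1]%classic : set R)).
  exact: integrable_indic_itv.
rewrite (le_trans (le_normr_Rintegral _ (integrable_Gl x)))//.
rewrite (@le_trans _ _ (\int[mu]_s (C * (oneDsqr x)^-1 *
    \1_(`[0, 1]%classic : set R) s)))//.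
  apply: le_Rintegral => //.
  - exact: (integrable_norm (integrable_Gl x)).
  - under [X in integrable _ _ X]eq_fun do rewrite /= EFinM.
    exact: (integrableZl measurableT _ i01).
  - by move=> s _; rewrite (le_trans (G_le s x))// mulrA mulrAC.
rewrite RintegralZl// /Rintegral integral_indic//= setIT.
by rewrite lebesgue_measure_itv/= lte_fin ltr01 oppr0 addr0 mulr1.
Qed.

Let integrable_inner :
  mu.-integrable [set: R] (fun x => \int[mu]_s F (s, x))%E.
Proof.
under [X in integrable _ _ X]eq_fun do rewrite innerE.
apply: (@le_oneDsqr_integrable _ _ C).
  apply/measurable_EFinP; rewrite (_ : _ \o _ = fubini_G mu F).
    exact: (measurable_fubini_G integrableF).
  by apply/funext => x /=; rewrite -innerE.
by move=> x; rewrite normrM -[leRHS]mulr1 ler_pM// Rintegral_G_le.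
Qed.

(** Fubini's theorem. The factor [e] will be [cos (t * x)] or [sin (t * x)]. *)
Lemma Rintegral_polya_densityM : \int[mu]_x (polya_density x * e x) =
  cosq_mass^-1 * \int[mu]_s (\int[mu]_x (G s x * e x)).
Proof.
have FE : (\int[mu]_x \int[mu]_s F (s, x) =
    \int[mu]_s (\int[mu]_x (G s x * e x))%:E)%E.
  rewrite -(Fubini integrableF); apply: eq_integral => s _.
  rewrite /Rintegral fineK//.
  exact: (integrable_fin_num measurableT (integrable_Gr s me e1)).
rewrite [LHS]/Rintegral.
under eq_integral do rewrite EFin_densityE.
rewrite integralZl// fineM//; first by rewrite FE.
exact: (integrable_fin_num measurableT integrable_inner).
Qed.

Lemma integrable_polya_densityM :
  mu.-integrable [set: R] (fun x => (polya_density x * e x)%:E).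
Proof.
under [X in integrable _ _ X]eq_fun do rewrite EFin_densityE.
exact: (integrableZl measurableT _ integrable_inner).
Qed.

End fubini.

Let kernelE s (e : R -> R) x : G s x * e x =
  a s * ((1 - cos (s * x)) / x ^+ 2 * e x) -
  b s * ((sin (s * x) - s * sin x) / x ^+ 2 * e x).
Proof. by rewrite /G mulrBl mulrBl !mulrA. Qed.

Let Rintegral_kernel s (e : R -> R) : measurable_fun [set: R] e ->
  (forall x, `|e x| <= 1) -> s \in `[0, 1] -> \int[mu]_x (G s x * e x) =
  a s * (\int[mu]_x ((1 - cos (s * x)) / x ^+ 2 * e x)) -
  b s * (\int[mu]_x ((sin (s * x) - s * sin x) / x ^+ 2 * e x)).
Proof.
move=> me e1; rewrite in_itv/= => s01.
have i1 := integrable_1Bcos s01 me e1.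
have i2 := integrable_sin_defect s01 me e1.
under eq_Rintegral do rewrite kernelE.
rewrite RintegralB//.
- by rewrite !RintegralZl.
- exact: (integrableZl measurableT _ i1).
- exact: (integrableZl measurableT _ i2).
Qed.

Let Rintegral_kernel_cos s t : \int[mu]_x (G s x * cos (t * x)) =
  cosq_mass * (a s * ((`|s + t| + `|s - t|) / 2 - `|t|)).
Proof.
have [s01|s01] := boolP (s \in `[0, 1]); last first.
  rewrite a_out// mul0r mulr0 /Rintegral.
  by under eq_integral do rewrite G_out// mul0r; rewrite integral0.
rewrite Rintegral_kernel//; last 2 first.
- exact: measurable_cosM.
- by move=> x; exact: cos_max.
rewrite Rintegral_1Bcos_cos Rintegral_sin_defect_cos; last by rewrite in_itv in s01.
by rewrite mulr0 subr0 mulrCA.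
Qed.

Let Rintegral_kernel_sin s t : \int[mu]_x (G s x * sin (t * x)) =
  cosq_mass * - (b s * ((`|s + t| - `|s - t|) / 2
                        - s * ((`|1 + t| - `|1 - t|) / 2))).
Proof.
have [s01|s01] := boolP (s \in `[0, 1]); last first.
  rewrite b_out// mul0r oppr0 mulr0 /Rintegral.
  by under eq_integral do rewrite G_out// mul0r; rewrite integral0.
rewrite Rintegral_kernel//; last 2 first.
- exact: measurable_sinM.
- by move=> x; exact: sin_max.
rewrite Rintegral_sin_defect_sin Rintegral_1Bcos_sin; last by rewrite in_itv in s01.
by rewrite mulr0 sub0r mulrCA mulrN.
Qed.

Let integrable_out (f h : R -> R) N : measurable_fun [set: R] f ->
  (forall s, s \notin `[0, 1] -> f s = 0) ->
  (forall s, s \in `[0, 1] -> `|f s| <= N) -> continuous h ->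
  mu.-integrable [set: R] (EFin \o (fun s => f s * h s)).
Proof.
move=> mf f0 fN ch.
have /integrable_mkcond : mu.-integrable `[0, 1] (EFin \o (fun s => f s * h s)).
  have ih : mu.-integrable `[0, 1] (EFin \o h).
    apply: continuous_compact_integrable; first exact: segment_compact.
    exact: continuous_subspaceT.
  apply: (integrableMr _ _ _ ih) => //; first exact: measurable_funTS.
  exists N; split; first exact: num_real.
  by move=> N' NN' s /= s01; rewrite (le_trans (fN _ s01))// ltW.
move=> /(_ (measurable_itv _)); apply: eq_integrable => // s _.
rewrite patchE; case: ifPn => //; rewrite notin_setE/= => s01.
by rewrite f0 ?mul0r//; exact/negP.
Qed.

Lemma Rintegral_polya_density_cos t :
  \int[mu]_x (polya_density x * cos (t * x)) =
  \int[mu]_s (a s * ((`|s + t| + `|s - t|) / 2 - `|t|)).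
Proof.
rewrite Rintegral_polya_densityM; last 2 first.
- exact: measurable_cosM.
- by move=> x; exact: cos_max.
under eq_Rintegral do rewrite Rintegral_kernel_cos.
rewrite RintegralZl//; first by rewrite mulKf// gt_eqF// cosq_mass_gt0.
apply: (@integrable_out _ _ M) => //.
  by move=> s s01; have /andP[a1 aM] := a_in s01; rewrite ger0_norm//; lra.
move=> s; apply: cvgB; last exact: cvg_cst.
by apply: cvgMl; apply: cvgD; [exact: continuous_normD|exact: continuous_normB].
Qed.

Lemma Rintegral_polya_density_sin t :
  \int[mu]_x (polya_density x * sin (t * x)) =
  \int[mu]_s - (b s * ((`|s + t| - `|s - t|) / 2
                        - s * ((`|1 + t| - `|1 - t|) / 2))).
Proof.
rewrite Rintegral_polya_densityM; last 2 first.
- exact: measurable_sinM.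
- by move=> x; exact: sin_max.
under eq_Rintegral do rewrite Rintegral_kernel_sin.
rewrite RintegralZl//; first by rewrite mulKf// gt_eqF// cosq_mass_gt0.
under [X in integrable _ _ X]eq_fun do rewrite /= -mulrN.
apply: (@integrable_out _ _ 5^-1) => //.
move=> s; apply: cvgN; apply: cvgB.
  by apply: cvgMl; apply: cvgB; [exact: continuous_normD|exact: continuous_normB].
by apply: cvgMl; exact: cvg_id.
Qed.

Lemma exists_polya_prob : \int[mu]_s (a s * s) = 1 ->
  exists P : probability (measurableTypeR R) R, forall t,
    \int[P]_x cos (t * x) =
      \int[mu]_s (a s * ((`|s + t| + `|s - t|) / 2 - `|t|)) /\
    \int[P]_x sin (t * x) =
      \int[mu]_s - (b s * ((`|s + t| - `|s - t|) / 2
                        - s * ((`|1 + t| - `|1 - t|) / 2))).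
Proof.
move=> a1.
have i1 : mu.-integrable [set: R] (EFin \o polya_density).
  have /= := @integrable_polya_densityM (fun=> 1) _ _.
  under [X in integrable _ _ X]eq_fun do rewrite mulr1.
  by apply => // x; rewrite normr1.
(* The total mass is the cosine transform at [t = 0], where the weight of [a s] reduces to [s]. *)
have d1 : \int[mu]_x polya_density x = 1.
  rewrite -a1; have := Rintegral_polya_density_cos 0.
  under eq_Rintegral do rewrite mul0r cos0 mulr1.
  move=> ->; apply: eq_Rintegral => s _.
  have [s01|s01] := boolP (s \in `[0, 1]); last by rewrite a_out// !mul0r.
  have s0 : 0 <= s by move: s01; rewrite in_itv/= => /andP[].
  by rewrite addr0 subr0 normr0 subr0 ger0_norm// mulrDl -splitr.
have [P PE] := exists_density_prob polya_density_ge0 i1 d1.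
exists P => t; split.
  rewrite PE -?Rintegral_polya_density_cos//.
  - by apply: eq_Rintegral => x _; rewrite mulrC.
  - exact: measurable_cosM.
  - by move=> x; exact: cos_max.
rewrite PE -?Rintegral_polya_density_sin//.
- by apply: eq_Rintegral => x _; rewrite mulrC.
- exact: measurable_sinM.
- by move=> x; exact: sin_max.
Qed.

End kernel.

(** * Recovering a function from its second derivative *)

Section C2.
Context {R : realType}.
Implicit Types s t x : R.
Local Notation mu := (@lebesgue_measure R).

Lemma Rintegral_eq0 (D : set R) (f : R -> R) : {in D, forall s, f s = 0} ->
  \int[mu]_(s in D) f s = 0.
Proof.
move=> f0; rewrite (@eq_Rintegral _ _ _ mu D (cst 0) f)//.
by rewrite /Rintegral integral0.
Qed.

Lemma Rintegral_split01 (f : R -> R) t : 0 <= t <= 1 ->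
  mu.-integrable `[0, 1] (EFin \o f) ->
  \int[mu]_(s in `[0, 1]) f s =
  \int[mu]_(s in `[0, t]) f s + \int[mu]_(s in `[t, 1]) f s.
Proof.
move=> /andP[t0 t1] fi.
rewrite -(@Rintegral_itv_obnd_cbnd _ t); last first.
  by apply: integrableS fi => //; apply: subset_itvr; rewrite bnd_simp.
by rewrite -(Rintegral_itvB fi) ?bnd_simp// addrC subrK.
Qed.

Lemma continuous_integrable01 (f : R -> R) : continuous f ->
  mu.-integrable `[0, 1] (EFin \o f).
Proof.
move=> cf; apply: continuous_compact_integrable; first exact: segment_compact.
exact: continuous_subspaceT.
Qed.

Lemma Rintegral_patch01 (f h : R -> R) :
  \int[mu]_s ((f \_ `[0, 1]) s * h s) = \int[mu]_(s in `[0, 1]) (f s * h s).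
Proof.
rewrite [RHS]Rintegral_mkcond; apply: eq_Rintegral => s _.
by rewrite !patchE; case: ifPn => //; rewrite mul0r.
Qed.

(** For [s, t >= 0] the weight of [u2 s] is the positive part of [s - t]. Integration by parts on
    [[t, 1]] leaves [u t], the boundary terms at [1] being zero; for [t > 1] the weight vanishes on
    [[0, 1]]. *)
Lemma Rintegral_green_even (u u1 u2 : R -> R) t :
  (forall s, is_derive s 1 u (u1 s)) -> (forall s, is_derive s 1 u1 (u2 s)) ->
  continuous u2 -> u 1 = 0 -> u1 1 = 0 -> 0 <= t ->
  \int[mu]_(s in `[0, 1]) (u2 s * ((`|s + t| + `|s - t|) / 2 - `|t|)) =
  if t <= 1 then u t else 0.
Proof.
move=> du du1 cu2 uE u1E t0.
have low s : 0 <= s <= t -> (`|s + t| + `|s - t|) / 2 - `|t| = 0.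
  move=> /andP[s0 st]; rewrite ger0_norm ?addr_ge0// ler0_norm ?subr_le0//.
  by rewrite ger0_norm//; lra.
have [t1|t1] := leP t 1; last first.
  apply: Rintegral_eq0 => s; rewrite inE/= in_itv/= => /andP[s0 s1].
  by rewrite low ?mulr0// s0 (le_trans s1 (ltW t1)).
rewrite (@Rintegral_split01 _ t) ?t0//; last first.
  apply: continuous_integrable01 => s; apply: cvgM; first exact: cu2.
  apply: cvgB; last exact: cvg_cst.
  by apply: cvgMl; apply: cvgD; [exact: continuous_normD|exact: continuous_normB].
rewrite (_ : \int[mu]_(s in `[0, t]) _ = 0) ?add0r; last first.
  by apply: Rintegral_eq0 => s; rewrite inE/= in_itv/= => /low ->; rewrite mulr0.
transitivity (\int[mu]_(s in `[t, 1]) (u2 s * (s - t))).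
  apply: eq_Rintegral => s; rewrite inE/= in_itv/= => /andP[ts s1].
  rewrite ger0_norm ?addr_ge0// ?(le_trans t0)// ger0_norm ?subr_ge0//.
  by rewrite ger0_norm//; congr (_ * _); lra.
have dF (s : R) : is_derive s 1 (fun s => u1 s * (s - t) - u s) (u2 s * (s - t)).
  by apply: is_derive_eq; rewrite /GRing.scale /=; ring.
rewrite (Rintegral_FTC t1 dF) ?uE ?u1E ?subrr ?mul0r ?mulr0 ?sub0r ?opprK//.
  by rewrite oppr0 add0r.
move=> s; apply: cvgM; first exact: cu2.
by apply: cvgB; [exact: cvg_id|exact: cvg_cst].
Qed.

(** Half the difference of absolute values is [min (s, t)]. For [t <= 1] the weight is thus the
    Green function with zero boundary values, equal to [(t - 1) * s] before [t] and to [t * (s - 1)]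
    after it; for [t > 1] it is [s - s = 0]. In the sum of the two integrals the terms in [v1 t]
    cancel. *)
Lemma Rintegral_green_odd (v v1 v2 : R -> R) t :
  (forall s, is_derive s 1 v (v1 s)) -> (forall s, is_derive s 1 v1 (v2 s)) ->
  continuous v2 -> v 0 = 0 -> v 1 = 0 -> 0 <= t ->
  \int[mu]_(s in `[0, 1]) (v2 s * - ((`|s + t| - `|s - t|) / 2
                        - s * ((`|1 + t| - `|1 - t|) / 2))) =
  if t <= 1 then v t else 0.
Proof.
move=> dv dv1 cv2 v0 v1E t0.
have [t1|t1] := leP t 1; last first.
  apply: Rintegral_eq0 => s; rewrite inE/= in_itv/= => /andP[s0 s1].
  rewrite (ger0_norm (addr_ge0 s0 t0)) (ger0_norm (addr_ge0 ler01 t0)).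
  rewrite ler0_norm ?subr_le0 ?(le_trans s1 (ltW t1))//.
  by rewrite ler0_norm ?subr_le0 ?(ltW t1)//; field.
rewrite (@Rintegral_split01 _ t) ?t0//; last first.
  apply: continuous_integrable01 => s; apply: cvgM; first exact: cv2.
  apply: cvgN; apply: cvgB; last by apply: cvgMl; exact: cvg_id.
  by apply: cvgMl; apply: cvgB; [exact: continuous_normD|exact: continuous_normB].
have -> : \int[mu]_(s in `[0, t]) (v2 s * - ((`|s + t| - `|s - t|) / 2
      - s * ((`|1 + t| - `|1 - t|) / 2))) =
    \int[mu]_(s in `[0, t]) (v2 s * ((t - 1) * s)).
  apply: eq_Rintegral => s; rewrite inE/= in_itv/= => /andP[s0 st].
  rewrite (ger0_norm (addr_ge0 s0 t0)) (ger0_norm (addr_ge0 ler01 t0)).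
  by rewrite ler0_norm ?subr_le0// ger0_norm ?subr_ge0//; field.
have -> : \int[mu]_(s in `[t, 1]) (v2 s * - ((`|s + t| - `|s - t|) / 2
      - s * ((`|1 + t| - `|1 - t|) / 2))) =
    \int[mu]_(s in `[t, 1]) (v2 s * (t * (s - 1))).
  apply: eq_Rintegral => s; rewrite inE/= in_itv/= => /andP[ts s1].
  rewrite (ger0_norm (addr_ge0 (le_trans t0 ts) t0)).
  rewrite (ger0_norm (addr_ge0 ler01 t0)).
  by rewrite ger0_norm ?subr_ge0// ger0_norm ?subr_ge0//; field.
have dF (s : R) : is_derive s 1 (fun s => (t - 1) * (v1 s * s - v s))
    (v2 s * ((t - 1) * s)).
  by apply: is_derive_eq; rewrite /GRing.scale /=; ring.
have dH (s : R) : is_derive s 1 (fun s => t * (v1 s * (s - 1) - v s))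
    (v2 s * (t * (s - 1))).
  by apply: is_derive_eq; rewrite /GRing.scale /=; ring.
rewrite (Rintegral_FTC t0 dF); last first.
  by move=> s; apply: cvgM; [exact: cv2|apply: cvgMr; exact: cvg_id].
rewrite (Rintegral_FTC t1 dH) ?v0 ?v1E; first by ring.
move=> s; apply: cvgM; first exact: cv2.
by apply: cvgMr; apply: cvgB; [exact: cvg_id|exact: cvg_cst].
Qed.

(** Restricting to [t >= 0] loses nothing: conjugation gives the values at negative arguments. *)
Lemma exists_C2_prob (u u1 u2 v v1 v2 : R -> R) (M : R) :
  (forall s, is_derive s 1 u (u1 s)) -> (forall s, is_derive s 1 u1 (u2 s)) ->
  (forall s, is_derive s 1 v (v1 s)) -> (forall s, is_derive s 1 v1 (v2 s)) ->
  continuous u2 -> continuous v2 ->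
  u 0 = 1 -> u 1 = 0 -> u1 1 = 0 -> v 0 = 0 -> v 1 = 0 ->
  (forall s, 0 <= s <= 1 -> 1 <= u2 s <= M) ->
  (forall s, 0 <= s <= 1 -> `|v2 s| <= 5^-1) ->
  exists P : probability (measurableTypeR R) R, forall t, 0 <= t ->
    \int[P]_x cos (t * x) = (if t <= 1 then u t else 0) /\
    \int[P]_x sin (t * x) = (if t <= 1 then v t else 0).
Proof.
move=> du du1 dv dv1 cu2 cv2 u01 uE u1E v0 v1E uM vM.
have out (f : R -> R) (s : R) : s \notin `[0, 1] -> (f \_ `[0, 1]) s = 0.
  by move=> s01; rewrite patchE memNset//; exact/negP.
have inn (f : R -> R) (s : R) : s \in `[0, 1] -> (f \_ `[0, 1]) s = f s.
  by move=> s01; rewrite patchE mem_set.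
have mp (f : R -> R) : continuous f -> measurable_fun [set: R] (f \_ `[0, 1]).
  move=> cf; apply: (measurable_restrictT _ _).1; first exact: measurable_itv.
  exact: (measurable_funTS (continuous_measurable_fun cf)).
have [|||||||P PE] := @exists_polya_prob R (u2 \_ `[0, 1]) (v2 \_ `[0, 1]) M.
- exact: mp.
- exact: mp.
- exact: out.
- exact: out.
- by move=> s s01; rewrite inn//; apply: uM; move: s01; rewrite in_itv.
- by move=> s s01; rewrite inn//; apply: vM; move: s01; rewrite in_itv.
(* The normalization is the even Green formula at [t = 0], combined with [u 0 = 1]. *)
- rewrite Rintegral_patch01.
  have := @Rintegral_green_even u u1 u2 0 du du1 cu2 uE u1E (lexx 0).
  rewrite ler01 u01 => I1; rewrite -[RHS]I1; apply: eq_Rintegral => s.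
  rewrite inE/= in_itv/= => /andP[s0 _].
  by rewrite addr0 subr0 normr0 subr0 ger0_norm// mulrDl -splitr.
exists P => t t0; have [-> ->] := PE t; split.
  by rewrite Rintegral_patch01 (Rintegral_green_even du du1).
under eq_Rintegral do rewrite -mulrN.
by rewrite Rintegral_patch01 (Rintegral_green_odd dv dv1).
Qed.

End C2.

(** * Truncated exponentials as characteristic functions *)

Section exponential.
Context {R : realType}.
Implicit Types s t x : R.

(** Meant for [t >= 0]. The double zero at [1] yields [u 1 = u' 1 = 0], and the second derivative
    [2] leaves a margin above the required [1]. *)
Definition tent t : R := if t <= 1 then (1 - t) ^+ 2 else 0.

Variables (A A1 A2 B B1 B2 : R -> R).
Hypothesis dA : forall s, is_derive s 1 A (A1 s).
Hypothesis dA1 : forall s, is_derive s 1 A1 (A2 s).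
Hypothesis dB : forall s, is_derive s 1 B (B1 s).
Hypothesis dB1 : forall s, is_derive s 1 B1 (B2 s).
Hypothesis cA2 : continuous A2.
Hypothesis cB2 : continuous B2.
Hypothesis A0 : A 0 = 0.
Hypothesis B0 : B 0 = 0.
Hypothesis small : forall s, 0 <= s <= 1 ->
  [/\ `|A s| <= 200^-1, `|A1 s| <= 200^-1 & `|A2 s| <= 200^-1] /\
  [/\ `|B s| <= 200^-1, `|B1 s| <= 200^-1 & `|B2 s| <= 200^-1].

(** [E] and [F] are the real and imaginary parts of [exp (A + i B)]. Their derivatives are kept in
    terms of lower ones, which makes them easy to bound. *)
Let E s := expR (A s) * cos (B s).
Let F s := expR (A s) * sin (B s).
Let E1 s := A1 s * E s - B1 s * F s.
Let F1 s := A1 s * F s + B1 s * E s.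
Let E2 s := A2 s * E s + A1 s * E1 s - B2 s * F s - B1 s * F1 s.
Let F2 s := A2 s * F s + A1 s * F1 s + B2 s * E s + B1 s * E1 s.

Let dexpA s : is_derive s 1 (fun s => expR (A s)) (expR (A s) * A1 s).
Proof. exact: (@is_derive1_comp _ expR A). Qed.

Let dcosB s : is_derive s 1 (fun s => cos (B s)) (- sin (B s) * B1 s).
Proof. exact: (@is_derive1_comp _ cos B). Qed.

Let dsinB s : is_derive s 1 (fun s => sin (B s)) (cos (B s) * B1 s).
Proof. exact: (@is_derive1_comp _ sin B). Qed.

Let dE s : is_derive s 1 E (E1 s).
Proof.
by apply: is_derive_eq; rewrite /GRing.scale /= /E1 /E /F; ring.
Qed.

Let dF s : is_derive s 1 F (F1 s).
Proof.
by apply: is_derive_eq; rewrite /GRing.scale /= /F1 /E /F; ring.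
Qed.

Let dE1 s : is_derive s 1 E1 (E2 s).
Proof.
by apply: is_derive_eq; rewrite /GRing.scale /= /E2 /E1 /F1 /E /F; ring.
Qed.

Let dF1 s : is_derive s 1 F1 (F2 s).
Proof.
by apply: is_derive_eq; rewrite /GRing.scale /= /F2 /E1 /F1 /E /F; ring.
Qed.

Let normM_le (x y c d : R) : `|x| <= c -> `|y| <= d -> `|x * y| <= c * d.
Proof. by move=> xc yd; rewrite normrM ler_pM. Qed.

Let EF_le s : 0 <= s <= 1 ->
  [/\ 1 - 100^-1 <= E s, `|E s| <= 2 & `|F s| <= 100^-1].
Proof.
move=> /small[[/ler_normlP[a1 a2] _ _] [/ler_normlP[b1 b2] _ _]].
(* The inequality at [- A s] bounds [expR (A s)] from above, as the two exponentials are inverse to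
   each other. *)
have e1 := expR_ge1Dx (A s); have e2 := expR_ge1Dx (- A s).
have e3 : expR (A s) * expR (- A s) = 1 by rewrite -expRD subrr expR0.
have e0 := expR_gt0 (A s).
have c1 := cos_ge_taylor2 (B s); have c2 := cos_le1 (B s).
have sB : `|sin (B s)| <= 200^-1.
  rewrite ler_norml; have [B0'|B0'] := leP 0 (B s).
    have := sin_leid B0'; have := @sin_ge0_pi R (B s).
    by have := @pi_ge2 R => pi2 /(_ _)/wrap[]; [apply/andP; split; lra|lra].
  have nB : 0 <= - B s by lra.
  have := sin_leid nB; have := @sin_ge0_pi R (- B s); rewrite sinN.
  by have := @pi_ge2 R => pi2 /(_ _)/wrap[]; [apply/andP; split; lra|lra].
have eu : expR (A s) <= 2 by nra.
have b3 : B s ^+ 2 <= 200^-1 by nra.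
have cpos : 0 <= cos (B s) by lra.
split.
- rewrite /E.
  have : (1 - 200^-1) * (1 - 400^-1) <= expR (A s) * cos (B s).
    by apply: ler_pM; lra.
  lra.
- by rewrite /E normrM (ger0_norm (ltW e0)) (ger0_norm cpos); nra.
- rewrite /F normrM (ger0_norm (ltW e0)).
  have := ler_pM (ltW e0) (normr_ge0 (sin (B s))) eu sB; lra.
Qed.

Let der_le s : 0 <= s <= 1 ->
  [/\ `|E1 s| <= 40^-1, `|F1 s| <= 40^-1, `|E2 s| <= 40^-1 & `|F2 s| <= 40^-1].
Proof.
move=> s01; have [_ e f] := EF_le s01.
have [[a a1 a2] [b b1 b2]] := small s01.
(* These are the two parts of [(k + i l) (E + i F)]; the estimate is [(2 + 1/100) / 200 <= 1/80]. *)
have h (k l : R) : `|k| <= 200^-1 -> `|l| <= 200^-1 ->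
    `|k * E s - l * F s| <= 80^-1 /\ `|k * F s + l * E s| <= 80^-1.
  move=> kk ll; have h1 := normM_le kk e; have h2 := normM_le kk f.
  have h3 := normM_le ll e; have h4 := normM_le ll f; split.
    by rewrite (le_trans (ler_normB _ _))//; lra.
  by rewrite (le_trans (ler_normD _ _))//; lra.
have [e1 f1] := h _ _ a1 b1; have [e2 f2] := h _ _ a2 b2.
have g1 := normM_le a1 e1; have g2 := normM_le a1 f1.
have g3 := normM_le b1 e1; have g4 := normM_le b1 f1.
split.
- by rewrite (le_trans e1)//; lra.
- by rewrite (le_trans f1)//; lra.
- have -> : E2 s = (A2 s * E s - B2 s * F s) + A1 s * E1 s - B1 s * F1 s.
    by rewrite /E2; ring.
  rewrite (le_trans (ler_normB _ _))// (le_trans (lerD (ler_normD _ _) (lexx _)))//.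
  by rewrite /E1 /F1; lra.
- have -> : F2 s = (A2 s * F s + B2 s * E s) + A1 s * F1 s + B1 s * E1 s.
    by rewrite /F2; ring.
  rewrite (le_trans (ler_normD _ _))// (le_trans (lerD (ler_normD _ _) (lexx _)))//.
  by rewrite /E1 /F1; lra.
Qed.

Lemma exists_tent_prob : exists P : probability (measurableTypeR R) R,
  forall t, 0 <= t ->
    \int[P]_x cos (t * x) = tent t * (expR (A t) * cos (B t)) /\
    \int[P]_x sin (t * x) = tent t * (expR (A t) * sin (B t)).
Proof.
(* The Leibniz rule for the squared profile times [H], to be used with [H = E] for [u] and [H = F]
   for [v]. *)
pose w (H : R -> R) s := (1 - s) ^+ 2 * H s.
pose w1 (H H1 : R -> R) s := - 2 * (1 - s) * H s + (1 - s) ^+ 2 * H1 s.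
pose w2 (H H1 H2 : R -> R) s :=
  2 * H s - 4 * (1 - s) * H1 s + (1 - s) ^+ 2 * H2 s.
have dw H H1 : (forall s, is_derive s 1 H (H1 s)) ->
    forall s, is_derive s 1 (w H) (w1 H H1 s).
  by move=> dH s; apply: is_derive_eq; rewrite /GRing.scale /= /w1; ring.
have dw1 H H1 H2 : (forall s, is_derive s 1 H (H1 s)) ->
    (forall s, is_derive s 1 H1 (H2 s)) ->
    forall s, is_derive s 1 (w1 H H1) (w2 H H1 H2 s).
  by move=> dH dH1 s; apply: is_derive_eq; rewrite /GRing.scale /= /w2 /w1; ring.
have cE := is_derive1_continuous dE; have cF := is_derive1_continuous dF.
have cE1 := is_derive1_continuous dE1; have cF1 := is_derive1_continuous dF1.
have cA1 := is_derive1_continuous dA1; have cB1 := is_derive1_continuous dB1.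
have cE2 : continuous E2.
  move=> s; apply: cvgB; last by apply: cvgM; [exact: cB1|exact: cF1].
  apply: cvgB; last by apply: cvgM; [exact: cB2|exact: cF].
  apply: cvgD; first by apply: cvgM; [exact: cA2|exact: cE].
  by apply: cvgM; [exact: cA1|exact: cE1].
have cF2 : continuous F2.
  move=> s; apply: cvgD; last by apply: cvgM; [exact: cB1|exact: cE1].
  apply: cvgD; last by apply: cvgM; [exact: cB2|exact: cE].
  apply: cvgD; first by apply: cvgM; [exact: cA2|exact: cF].
  by apply: cvgM; [exact: cA1|exact: cF1].
have c1B : continuous (fun s : R => 1 - s).
  by move=> s; apply: cvgB; [exact: cvg_cst|exact: cvg_id].
have cw2 H H1 H2 : continuous H -> continuous H1 -> continuous H2 ->
    continuous (w2 H H1 H2).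
  move=> cH cH1 cH2 s; apply: cvgD.
    apply: cvgB; first by apply: cvgMr; exact: cH.
    by apply: cvgM; [apply: cvgMr; exact: c1B|exact: cH1].
  apply: cvgM; last exact: cH2.
  by rewrite /= expr2; apply: cvgM; exact: c1B.
(* The two remaining Leibniz terms contribute [4/40 + 1/40 = 1/8]. *)
have w2_le H H1 H2 s : 0 <= s <= 1 -> `|H1 s| <= 40^-1 -> `|H2 s| <= 40^-1 ->
    `|w2 H H1 H2 s - 2 * H s| <= 8^-1.
  move=> /andP[s0 s1] h1 h2.
  have -> : w2 H H1 H2 s - 2 * H s = (1 - s) ^+ 2 * H2 s - (4 * (1 - s)) * H1 s.
    by rewrite /w2; ring.
  have k1 : `|(1 - s) ^+ 2| <= 1 by rewrite ger0_norm ?sqr_ge0//; nra.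
  have k2 : `|4 * (1 - s)| <= 4 by rewrite ger0_norm; lra.
  have := normM_le k1 h2; have := normM_le k2 h1.
  by move=> ? ?; rewrite (le_trans (ler_normB _ _))//; lra.
have E0 : E 0 = 1 by rewrite /E A0 B0 expR0 cos0 mulr1.
have F0 : F 0 = 0 by rewrite /F B0 sin0 mulr0.
have [|||||||P PE] := @exists_C2_prob R (w E) (w1 E E1) (w2 E E1 E2)
    (w F) (w1 F F1) (w2 F F1 F2) 5 (dw _ _ dE) (dw1 _ _ _ dE dE1)
    (dw _ _ dF) (dw1 _ _ _ dF dF1) (cw2 _ _ _ cE cE1 cE2)
    (cw2 _ _ _ cF cF1 cF2).
- by rewrite /w E0 subr0 expr1n mulr1.
- by rewrite /w subrr expr0n mul0r.
- by rewrite /w1 subrr expr0n mulr0 !mul0r addr0.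
- by rewrite /w F0 mulr0.
- by rewrite /w subrr expr0n mul0r.
(* Here [u''] lies between [2 (1 - 1/100) - 1/8 >= 1] and [4 + 1/8 <= 5]; in the next goal
   [|v''| <= 2/100 + 1/8 <= 1/5]. *)
- move=> s s01; have [e1 e2 _] := EF_le s01; have [d1 _ d2 _] := der_le s01.
  have /ler_normlP[h1 h2] := w2_le E _ _ _ s01 d1 d2.
  have /ler_normlP[e3 e4] := e2.
  by apply/andP; split; lra.
- move=> s s01; have [_ _ f1] := EF_le s01; have [_ d1 _ d2] := der_le s01.
  have /ler_normlP[h1 h2] := w2_le F _ _ _ s01 d1 d2.
  have /ler_normlP[e3 e4] := f1.
  by rewrite ler_norml; apply/andP; split; lra.
exists P => t t0; have [-> ->] := PE t t0.
by rewrite /tent /w; case: ifPn; rewrite ?mul0r.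
Qed.

End exponential.

(** * Real and imaginary parts of a polynomial *)

Local Open Scope complex_scope.

Section polynomials.
Context {R : realType}.
Implicit Types (p : {poly R}) (q : {poly R[i]}) (t x e : R).

Definition Re_poly q : {poly R} := \poly_(i < size q) complex.Re q`_i.
Definition Im_poly q : {poly R} := \poly_(i < size q) complex.Im q`_i.

Lemma coef_Re_poly q k : (Re_poly q)`_k = complex.Re q`_k.
Proof. by rewrite coef_poly; case: ltnP => // ?; rewrite nth_default. Qed.

Lemma coef_Im_poly q k : (Im_poly q)`_k = complex.Im q`_k.
Proof. by rewrite coef_poly; case: ltnP => // ?; rewrite nth_default. Qed.

Lemma horner_real_complex q t :
  q.[t%:C] = (Re_poly q).[t] +i* (Im_poly q).[t].
Proof.
have qE : q = map_poly (real_complex R) (Re_poly q) +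
    'i *: map_poly (real_complex R) (Im_poly q).
  apply/polyP => k; rewrite coefD coefZ !coef_map; exact: complexE.
by rewrite {1}qE hornerD hornerZ !horner_map [RHS]complexE.
Qed.

(** The polynomial [p (- X)], given by its coefficients so that a symmetry of the function becomes a
    parity condition on them. *)
Definition reflect_poly p : {poly R} := \poly_(i < size p) ((-1) ^+ i * p`_i).

Lemma coef_reflect_poly p k : (reflect_poly p)`_k = (-1) ^+ k * p`_k.
Proof. by rewrite coef_poly; case: ltnP => // ?; rewrite nth_default ?mulr0. Qed.

Lemma horner_reflect_poly p t : (reflect_poly p).[t] = p.[- t].
Proof.
rewrite horner_poly horner_coef; apply: eq_bigr => i _.
by rewrite [in RHS]exprNn mulrCA mulrA.
Qed.

(** The [size p] distinct points [e / (i + 2)] are too many roots; the shift by two keeps them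
    strictly below [e]. *)
Lemma poly_eq0_itv p e : 0 < e -> (forall t, 0 < t < e -> p.[t] = 0) -> p = 0.
Proof.
move=> e0 pe; pose f (i : nat) : R := e / (i.+2)%:R.
have finj : injective f.
  move=> i j /(mulfI (lt0r_neq0 e0))/invr_inj/eqP.
  by rewrite eqr_nat => /eqP[].
apply: (@roots_geq_poly_eq0 _ p [seq f i | i <- iota 0 (size p)]).
- apply/allP => _ /mapP[i _ ->]; apply/eqP/pe; rewrite /f divr_gt0//=.
  by rewrite ltr_pdivrMr// ltr_pMr// ltr1n.
- by rewrite map_inj_uniq ?iota_uniq.
- by rewrite size_map size_iota.
Qed.

Lemma poly_bounded01 p : exists2 M, 0 <= M &
  forall x, 0 <= x <= 1 -> `|p.[x]| <= M.
Proof.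
exists (\sum_(i < size p) `|p`_i|); first exact: sumr_ge0.
move=> x /andP[x0 x1]; rewrite horner_coef (le_trans (ler_norm_sum _ _ _))//.
apply: ler_sum => i _; rewrite normrM ler_piMr// normrX exprn_ile1//.
by rewrite ger0_norm.
Qed.

(** As [p] vanishes at [0], it is ['X] times some [r]. Each of the three quantities is then a factor
    in [[0, e]] times a value bounded on [[0, 1]]. *)
Lemma poly_scale_small p (eta : R) : p.[0] = 0 -> 0 < eta ->
  exists2 e0, 0 < e0 & forall e, 0 < e <= e0 -> forall s, 0 <= s <= 1 ->
    [/\ `|p.[e * s]| <= eta, `|e * p^`().[e * s]| <= eta &
        `|e ^+ 2 * p^`()^`().[e * s]| <= eta].
Proof.
move=> p0 eta0.
have /factor_theorem[r pE] : root p 0 by apply/eqP.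
have [M0 M0_ge0 rM] := poly_bounded01 r.
have [M1 M1_ge0 dM] := poly_bounded01 p^`().
have [M2 M2_ge0 ddM] := poly_bounded01 p^`()^`().
pose M := 1 + (M0 + M1 + M2).
have Mgt0 : 0 < M by rewrite ltr_pwDl// !addr_ge0.
(* The minimum with [1] keeps [e * s] in [[0, 1]], where the bounds hold. *)
exists (Num.min 1 (eta / M)) => [|e]; first by rewrite lt_min ltr01 divr_gt0.
rewrite le_min => /and3P[e0 e1]; rewrite ler_pdivlMr// => eM s /andP[s0 s1].
have es1 : 0 <= e * s <= 1.
  by rewrite mulr_ge0 ?(ltW e0)//= mulr_ile1// ltW.
have es_le : e * s <= e by rewrite ler_piMr// ltW.
have bnd (c m : R) : `|c| <= m -> m <= M -> forall k, 0 <= k <= e ->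
    `|k * c| <= eta.
  move=> cm mM k /andP[k0 ke]; rewrite normrM (ger0_norm k0) (le_trans _ eM)//.
  by rewrite ler_pM// (le_trans cm).
split.
- rewrite pE !hornerE oppr0 addr0 mulrC.
  apply: (bnd _ M0 (rM _ es1)); first by rewrite /M; lra.
  by rewrite mulr_ge0 ?(ltW e0).
- apply: (bnd _ M1 (dM _ es1)); first by rewrite /M; lra.
  by rewrite (ltW e0) lexx.
- apply: (bnd _ M2 (ddM _ es1)); first by rewrite /M; lra.
  by rewrite sqr_ge0/= expr2 ler_piMr// ltW.
Qed.

End polynomials.

(** * Laws whose characteristic functions are truncated exponentials of polynomials *)

Section laws.
Context {R : realType}.
Implicit Types (p : {poly R}) (t x e : R).

Lemma is_derive_horner_scale p e (s : R) :
  is_derive s 1 (fun s : R => p.[e * s]) (e * p^`().[e * s]).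
Proof.
have d1 : is_derive s 1 (fun s : R => e * s) e.
  by apply: is_derive_eq; rewrite /GRing.scale /=; lra.
rewrite mulrC.
exact: (@is_derive1_comp _ (horner p) (fun s : R => e * s)).
Qed.

(** All small scales [e] are allowed, so that two such laws can share one scale. *)
Lemma exists_horner_prob (a b : {poly R}) : a.[0] = 0 -> b.[0] = 0 ->
  exists2 e0, 0 < e0 & forall e, 0 < e <= e0 ->
    exists P : probability (measurableTypeR R) R, forall t, 0 <= t ->
    \int[P]_x cos (t / e * x) = tent (t / e) * (expR a.[t] * cos b.[t]) /\
    \int[P]_x sin (t / e * x) = tent (t / e) * (expR a.[t] * sin b.[t]).
Proof.
move=> a0 b0; have eta0 : 0 < 200^-1 :> R by rewrite invr_gt0.
have [ea ea0 aM] := poly_scale_small a0 eta0.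
have [eb eb0 bM] := poly_scale_small b0 eta0.
exists (Num.min ea eb) => [|e]; first by rewrite lt_min ea0.
rewrite le_min => /and3P[e0 eea eeb].
have dd p (s : R) : is_derive s 1 (fun s : R => e * p^`().[e * s])
    (e ^+ 2 * p^`()^`().[e * s]).
  have := is_derive_horner_scale p^`() e s => ?.
  by apply: is_derive_eq; rewrite /GRing.scale /=; ring.
have cc p : continuous (fun s : R => e ^+ 2 * p^`()^`().[e * s]).
  move=> s; apply: cvgMr.
  exact: (is_derive1_continuous (is_derive_horner_scale _ e)).
have [| | |P PE] := @exists_tent_prob R (fun s => a.[e * s]) _ _
  (fun s => b.[e * s]) _ _ (is_derive_horner_scale a e) (dd a)
  (is_derive_horner_scale b e) (dd b) (cc a) (cc b).
- by rewrite mulr0.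
- by rewrite mulr0.
- by move=> s s01; split; [apply: aM|apply: bM] => //; rewrite e0.
exists P => t t0; have [|-> ->] := PE (t / e); first by rewrite divr_ge0// ltW.
by rewrite [e * _]mulrC divfK// gt_eqF.
Qed.

End laws.

(** * Coupling and characteristic functions *)

Section coupling.
Context {R : realType}.
Context {d1 d2} {T1 : measurableType d1} {T2 : measurableType d2}.
Variables (P1 : probability T1 R) (P2 : probability T2 R).

(** [X] and [Y] must live on a single probability space; the coordinates of a product space have the
    two prescribed laws. *)
Lemma Rintegral_prod_fst (g : T1 -> R) :
  measurable_fun [set: T1] g -> (forall x, `|g x| <= 1) ->
  \int[(P1 \x P2)%E]_z g z.1 = \int[P1]_x g x.
Proof.
move=> mg g1; rewrite /Rintegral -(@integral12_prod_meas1 _ _ _ _ _ P1 P2).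
  congr fine; apply: eq_integral => x _.
  rewrite /fubini_F/= integral_cst//.
  by rewrite [X in (_ * X)%E](probability_setT P2) mule1.
apply: (@integrable_probability_bounded _ _ _ (P1 \x P2)%E) => //.
exact: (measurableT_comp mg measurable_fst).
Qed.

Lemma Rintegral_prod_snd (g : T2 -> R) :
  measurable_fun [set: T2] g -> (forall x, `|g x| <= 1) ->
  \int[(P1 \x P2)%E]_z g z.2 = \int[P2]_x g x.
Proof.
move=> mg g1; rewrite /Rintegral -(@integral21_prod_meas1 _ _ _ _ _ P1 P2).
  congr fine; apply: eq_integral => x _.
  rewrite /fubini_G/= integral_cst//.
  by rewrite [X in (_ * X)%E](probability_setT P1) mule1.
apply: (@integrable_probability_bounded _ _ _ (P1 \x P2)%E) => //.
exact: (measurableT_comp mg measurable_snd).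
Qed.

End coupling.

Section charfun.
Context {R : realType}.

Lemma charfunN d (T : measurableType d) (P : probability T R)
    (X : {RV P >-> R}) (t : R) :
  charfun P X (- t) =
  complex.Re (charfun P X t) +i* - complex.Im (charfun P X t).
Proof.
rewrite /charfun/=; congr (_ +i* _).
  by apply: eq_Rintegral => w _; rewrite mulNr cosN.
rewrite -[RHS]mulN1r -RintegralZl//.
  by apply: eq_Rintegral => w _; rewrite mulNr sinN mulN1r.
apply: integrable_probability_bounded => [|w]; last exact: sin_max.
exact: (measurableT_comp (measurable_sinM t) (measurable_funP X)).
Qed.

(** Dominated convergence makes the real part continuous at [0], where it equals [1]. *)
Lemma Re_charfun_gt0 d (T : measurableType d) (P : probability T R)
    (X : {RV P >-> R}) : exists2 e : R, 0 < e &
  forall t, `|t| < e -> 0 < complex.Re (charfun P X t).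
Proof.
have mc t : measurable_fun [set: T] (fun w => cos (t * X w)).
  exact: (measurableT_comp (measurable_cosM t) (measurable_funP X)).
have c1 t w : `|cos (t * X w)| <= 1 by exact: cos_max.
have cI := @continuity_under_integral R _ T P (fun t w => cos (t * X w))
  setT measurableT (-1) 1.
have /= := cI _ _ (cst 1) _ _ 0.
have C0 : complex.Re (charfun P X 0) = 1.
  rewrite /= /Rintegral; under eq_integral do rewrite mul0r cos0.
  by rewrite integral_cst// mul1e [X in fine X](probability_setT P).
move=> /(_ _ _ _ _ _)/wrap[].
- by move=> t _; exact: integrable_probability_bounded.
- apply: aeW => w _ t _; apply: continuous_comp; first exact: mulrr_continuous.
  exact: continuous_cos.
- by apply: integrable_probability_bounded => // w; rewrite normr1.
- by move=> t _; apply: aeW => w _; exact: c1.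
- by rewrite inE/= in_itv/=; apply/andP; split; lra.
move=> /cvgrPdist_lt/(_ 1 ltr01)[e /= e0 eI].
exists e => // t te; have := eI t; rewrite /= sub0r normrN => /(_ te).
rewrite -[X in `|X - _|]/(complex.Re (charfun P X 0)) C0 /=.
by move=> /ltr_normlP[_]; rewrite ltrBlDr -ltrBlDl subrr.
Qed.

End charfun.

(** * Necessity and sufficiency of the parity condition *)

Section Q_identical.
Context {R : realType}.

(** Put [z = Yc + i Ys]. Multiplying the first equation by the conjugate of [z] and the second by
    [z] shows that [exp (a + i b)] and [exp (a' + i b')], both times [|z|^2], are conjugate. Moduli
    give [a = a']; the angles are compared only through their sines. *)
Lemma cexp_reflect_eq (Xc Xs Yc Ys a b a' b' : R) : 0 < Yc ->
  Xc +i* Xs = (Yc +i* Ys) * cexp (a +i* b) ->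
  Xc +i* - Xs = (Yc +i* - Ys) * cexp (a' +i* b') ->
  a = a' /\ sin b = - sin b'.
Proof.
move=> Yc0; rewrite /cexp /= => -[]; rewrite !mul0r subr0 !addr0 => h1 h2 [].
rewrite !mul0r subr0 !addr0 => h3 h4.
have N0 : Yc ^+ 2 + Ys ^+ 2 != 0.
  by rewrite gt_eqF// ltr_pwDl ?exprn_gt0// sqr_ge0.
have hc : expR a * cos b = expR a' * cos b'.
  apply: (mulfI N0).
  have -> : (Yc ^+ 2 + Ys ^+ 2) * (expR a * cos b) = Xc * Yc + Xs * Ys.
    by rewrite h1 h2; ring.
  rewrite -[Xs]opprK h4 h3; ring.
have hs : expR a * sin b = - (expR a' * sin b').
  apply: (mulfI N0).
  have -> : (Yc ^+ 2 + Ys ^+ 2) * (expR a * sin b) = Xs * Yc - Xc * Ys.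
    by rewrite h1 h2; ring.
  rewrite -[Xs]opprK h4 h3; ring.
have ee : expR a ^+ 2 = expR a' ^+ 2.
  rewrite -[LHS]mulr1 -[RHS]mulr1 -{1}(cos2Dsin2 b) -(cos2Dsin2 b').
  rewrite !mulrDr -!exprMn hc hs sqrrN //.
have aa : a = a'.
  apply: expR_inj; apply/eqP; rewrite -(eqrXn2 (n := 2)) ?expR_ge0//.
  exact/eqP.
split=> //; apply: (mulfI (lt0r_neq0 (expR_gt0 a))).
by rewrite hs aa mulrN.
Qed.

(** Near [0] the imaginary part of [q] stays below [1], hence below [pi / 2], where sine is
    injective. The symmetries obtained on a small interval are then polynomial identities. *)
Lemma charfun_quotient_symmetric d (T : measurableType d) (P : probability T R)
    (X Y : {RV P >-> R}) (q : {poly R[i]}) : q`_0 = 0 ->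
  (forall t, charfun P X t = charfun P Y t * cexp q.[t%:C]) ->
  reflect_poly (Re_poly q) = Re_poly q /\
  reflect_poly (Im_poly q) = - Im_poly q.
Proof.
move=> q0 XY; have [e e0 Y0] := Re_charfun_gt0 Y.
have I0 : (Im_poly q).[0] = 0 by rewrite horner_coef0 coef_Im_poly q0.
have [e' e'0 small] : exists2 e' : R, 0 < e' &
    forall t, `|t| < e' -> `|(Im_poly q).[t]| < 1.
  have /cvgrPdist_lt/(_ 1 ltr01)[e' /= e'0 eI] :=
    @continuous_horner R (Im_poly q) 0.
  exists e' => // t te; have := eI t; rewrite /= sub0r normrN => /(_ te).
  by rewrite I0 sub0r normrN.
have key t : 0 < t < Num.min e e' ->
    (Re_poly q).[- t] = (Re_poly q).[t] /\ (Im_poly q).[- t] = - (Im_poly q).[t].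
  rewrite lt_min => /and3P[t0 te te'].
  have nt : `|t| = t by rewrite gtr0_norm.
  have h1 := XY t; have h2 := XY (- t).
  rewrite horner_real_complex [X in X = _]complexE -complexE in h1.
  rewrite horner_real_complex !charfunN in h2.
  have [] := cexp_reflect_eq _ h1 h2.
    by apply: Y0; rewrite nt.
  move=> -> sE; split=> //.
  have pi2 := @pi_ge2 R.
  have /ltr_normlP[b1 b2] : `|(Im_poly q).[t]| < 1 by apply: small; rewrite nt.
  have /ltr_normlP[b3 b4] : `|(Im_poly q).[- t]| < 1.
    by apply: small; rewrite normrN nt.
  apply: (@sin_inj R); last by rewrite sinN sE opprK.
    by rewrite in_itv/=; apply/andP; split; lra.
  by rewrite in_itv/=; apply/andP; split; lra.
have m0 : 0 < Num.min e e' by rewrite lt_min e0.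
split; apply/eqP; rewrite -subr_eq0 ?opprK; apply/eqP;
  apply: (poly_eq0_itv m0) => t /key[kr ki].
  by rewrite hornerD hornerN horner_reflect_poly kr subrr.
by rewrite hornerD horner_reflect_poly ki addNr.
Qed.

Lemma exists_Q_identical (q : {poly R[i]}) : q`_0 = 0 ->
  (forall t, (Re_poly q).[- t] = (Re_poly q).[t]) ->
  (forall t, (Im_poly q).[- t] = - (Im_poly q).[t]) ->
  exists (d : measure_display) (T : measurableType d) (P : probability T R)
          (X Y : {RV P >-> R}),
      forall t : R, charfun P X t = charfun P Y t * cexp q.[t%:C].
Proof.
move=> q0 evenR oddI.
have R0 : (Re_poly q).[0] = 0 by rewrite horner_coef0 coef_Re_poly q0.
have I0 : (Im_poly q).[0] = 0 by rewrite horner_coef0 coef_Im_poly q0.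
have [e1 e10 L1] := exists_horner_prob R0 I0.
(* The law of [Y] comes from the zero polynomial; the common scale [e] gives [X] and [Y] the same
   factor [tent]. *)
have [e2 e20 L2] := exists_horner_prob (horner0 0) (horner0 (0 : R)).
pose e := Num.min e1 e2.
have e0 : 0 < e by rewrite lt_min e10.
have [|P1 P1E] := L1 e; first by rewrite e0 ge_min lexx.
have [|P2 P2E] := L2 e; first by rewrite e0 ge_min lexx orbT.
pose P : probability (measurableTypeR R * measurableTypeR R)%type R :=
  (P1 \x P2)%E.
have mX : measurable_fun [set: (measurableTypeR R * measurableTypeR R)%type]
    (fun z => z.1 / e : R).
  by apply: measurable_funM => //; exact: measurable_fst.
have mY : measurable_fun [set: (measurableTypeR R * measurableTypeR R)%type]
    (fun z => z.2 / e : R).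
  by apply: measurable_funM => //; exact: measurable_snd.
pose X : {RV P >-> R} := HB.pack
  (fun z : (measurableTypeR R * measurableTypeR R)%type => z.1 / e : R)
  (isMeasurableFun.Build _ _ _ _ _ mX).
pose Y : {RV P >-> R} := HB.pack
  (fun z : (measurableTypeR R * measurableTypeR R)%type => z.2 / e : R)
  (isMeasurableFun.Build _ _ _ _ _ mY).
exists _, _, P, X, Y => t.
have argE (s x : R) : s * (x / e) = s / e * x by rewrite mulrA mulrAC.
have mc (s : R) : measurable_fun [set: measurableTypeR R]
    (fun x : measurableTypeR R => cos (s / e * x)) by exact: measurable_cosM.
have ms (s : R) : measurable_fun [set: measurableTypeR R]
    (fun x : measurableTypeR R => sin (s / e * x)) by exact: measurable_sinM.
have XE s : charfun P X s =
    (\int[P1]_x cos (s / e * x)) +i* (\int[P1]_x sin (s / e * x)).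
  rewrite /charfun /=; congr (_ +i* _).
    rewrite -(Rintegral_prod_fst P1 P2 (mc s)); last first.
      by move=> x; exact: cos_max.
    by apply: eq_Rintegral => z _; rewrite argE.
  rewrite -(Rintegral_prod_fst P1 P2 (ms s)); last first.
    by move=> x; exact: sin_max.
  by apply: eq_Rintegral => z _; rewrite argE.
have YE s : charfun P Y s =
    (\int[P2]_x cos (s / e * x)) +i* (\int[P2]_x sin (s / e * x)).
  rewrite /charfun /=; congr (_ +i* _).
    rewrite -(Rintegral_prod_snd P1 P2 (mc s)); last first.
      by move=> x; exact: cos_max.
    by apply: eq_Rintegral => z _; rewrite argE.
  rewrite -(Rintegral_prod_snd P1 P2 (ms s)); last first.
    by move=> x; exact: sin_max.
  by apply: eq_Rintegral => z _; rewrite argE.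
have pos s : 0 <= s -> charfun P X s = (tent (s / e))%:C * cexp q.[s%:C] /\
    charfun P Y s = (tent (s / e))%:C.
  move=> s0; rewrite XE YE horner_real_complex.
  have [-> ->] := P1E s s0; have [-> ->] := P2E s s0.
  rewrite !horner0 expR0 cos0 sin0 !mulr1 !mulr0 /cexp; split=> //.
  by apply/eqP; rewrite eq_complex /= !mul0r !subr0 !addr0 !eqxx.
have [t0|t0] := leP 0 t; first by have [-> ->] := pos t t0.
(* For negative [t] both sides are conjugates of their values at [- t], by the parity of the two
   parts of [q]. *)
have [s s0 ->] : exists2 s, 0 <= s & t = - s.
  by exists (- t); rewrite ?opprK// oppr_ge0 ltW.
rewrite !charfunN; have [-> ->] := pos s s0.
rewrite !horner_real_complex evenR oddI /cexp cosN sinN.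
by apply/eqP; rewrite eq_complex /=; apply/andP; split; apply/eqP; ring.
Qed.

End Q_identical.

Theorem theorem2 (R : realType) (q : {poly R[i]}) (hq0 : q`_0 = 0) :
  (exists (d : measure_display) (T : measurableType d) (P : probability T R)
          (X Y : {RV P >-> R}),
      forall t : R, charfun P X t = charfun P Y t * cexp q.[t%:C])
  <->
  (forall k : nat, (1 <= k)%N ->
      (~~ odd k -> complex.Im q`_k = 0) /\ (odd k -> complex.Re q`_k = 0)).
Proof.
split=> [[d [T [P [X [Y XY]]]]] k _|h].
  have [/polyP/(_ k) + /polyP/(_ k)] := charfun_quotient_symmetric hq0 XY.
  rewrite coefN !coef_reflect_poly coef_Re_poly coef_Im_poly -signr_odd.
  (* A number equal to its own opposite is zero: even [k] uses the imaginary part, odd [k] the real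
     part. *)
  move=> hR hI; split=> ok; rewrite ?(negbTE ok) ?ok ?expr0 ?expr1 in hR hI.
    by move: hI; rewrite mul1r; lra.
  by move: hR; rewrite mulN1r; lra.
apply: exists_Q_identical => // t.
  rewrite -horner_reflect_poly; congr (_.[t]); apply/polyP => k.
  rewrite coef_reflect_poly coef_Re_poly -signr_odd.
  (* The parity condition starts at [k = 1]; index [0] is covered by [hq0]. *)
  have [->|k0] := posnP k; first by rewrite hq0 mulr0.
  by have [_] := h k k0; case: odd => [->|_]; rewrite ?mulr0// mul1r.
rewrite -horner_reflect_poly -hornerN; congr (_.[t]); apply/polyP => k.
rewrite coefN coef_reflect_poly coef_Im_poly -signr_odd.
have [->|k0] := posnP k; first by rewrite hq0 mulr0 oppr0.
by have [+ _] := h k k0; case: odd => [_|->]; rewrite ?mulr0 ?oppr0// mulN1r.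
Qed.
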